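(* Let $d\in\mathbb{N}^*$, $r\in[1,d]$, $c_*\ge 1$, $\upsilon\in[0,1]$, $\mu_1,\dots,\mu_d>0$ and $d_*=\sum_{i=1}^d\mu_i$. Consider, for $n$ large enough, the sequence model $$y_{j,\ell,\mathbf{k}}=\theta_{j,\ell,\mathbf{k}}+n^{-r/2}z_{j,\ell,\mathbf{k}},\qquad j=0,\dots,J,\ \ell\in B_j,\ \mathbf{k}\in D_j,$$ where the $z_{j,\ell,\mathbf{k}}$ are random variables (not necessarily independent or identically distributed) and the $\theta_{j,\ell,\mathbf{k}}$ are unknown coefficients. Suppose that there exist $\delta\ge 0$, $\lambda_*>0$, $Q_1>0$ and $Q_2>0$, independent of $n$, such that (A1) $\displaystyle \sup_{j\in\{0,\dots,J\}}\sup_{\ell\in B_j}2^{-j(d_*+\delta)}\sum_{\mathbf{k}\in D_j}\mathbb{E}\left(z_{j,\ell,\mathbf{k}}^2\right)\le Q_1$; (A2) $\displaystyle \sum_{j=j_0}^{J_*}\sum_{\ell\in B_j}\sum_{\mathbf{K}\in\mathcal{A}_j}\sum_{\mathbf{k}\in U_{j,\mathbf{K}}}\mathbb{E}\left(z_{j,\ell,\mathbf{k}}^2\,\mathbf{1}_{\left\{\sum_{\mathbf{k}'\in U_{j,\mathbf{K}}}z_{j,\ell,\mathbf{k}'}^2>\lambda_*2^{\delta j}L^d/4\right\}}\right)\le Q_2$. Let $\widehat\theta^*$ be the block estimator defined in the context, with these $\delta$ and $\lambda_*$. Let $s>0$, $0<p\le\infty$, $0<q\le\infty$, $M\in(0,\infty)$.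 (i) There exists a constant $C>0$ (independent of $n$) such that $$\sup_{\theta\in\boldsymbol{\Theta}^s_{p,q}(M)}R\left(\widehat\theta^*,\theta\right)\le C\rho_n,$$ where $$\rho_n=\begin{cases} n^{-2sr/(2s+\delta+d_*+\upsilon)}, & \text{for } q\le 2\le p,\\ (\log n/n)^{2sr/(2s+\delta+d_*+\upsilon)}, & \text{for } q\le p<2,\ sp>\max\left(d_*,(1-p/2)(\delta+d_*+\upsilon)\right).\end{cases}$$ (ii) If $\upsilon=0$, these rates hold without the restriction $q\le\min(p,2)$; that is, for every $0<q\le\infty$, the bound holds with $\rho_n=n^{-2sr/(2s+\delta+d_* )}$ for $p\ge 2$, and with $\rho_n=(\log n/n)^{2sr/(2s+\delta+d_* )}$ for $p<2$ and $sp>\max\left(d_*,(1-p/2)(\delta+d_* )\right)$.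
   Context: Notation. $\log$ is the natural logarithm, $\lfloor\cdot\rfloor$ is the floor, $(x)_+=\max(x,0)$, $\mathbb{N}^*=\{1,2,\dots\}$. Index sets. $J=\lfloor\log_2 n\rfloor$. For every integer $j\ge 0$: $B_j=\{1,\dots,\lfloor c_*2^{\upsilon j}\rfloor\}$ and $D_j=\prod_{i=1}^d\{0,\dots,\lfloor 2^{\mu_i j}\rfloor-1\}$; $\mathbf{k}=(k_1,\dots,k_d)$ denotes an element of $D_j$. Blocks. $L=\lfloor(r\log n)^{1/d}\rfloor$ is the block length, $j_0=\lfloor(1/\min_{i=1,\dots,d}\mu_i)\log_2 L\rfloor$ is the coarsest scale, and $J_*=\lfloor (r/(d_*+\delta+\upsilon))\log_2 n\rfloor$. For $j\in\{j_0,\dots,J_*\}$, $\mathcal{A}_j=\prod_{i=1}^d\{1,\dots,\lfloor 2^{\mu_i j}L^{-1}\rfloor\}$ is the set of block indices at scale $j$, and for $\mathbf{K}=(K_1,\dots,K_d)\in\mathcal{A}_j$, $U_{j,\mathbf{K}}=\{\mathbf{k}\in D_j:\ (K_i-1)L\le k_i\le K_iL-1\text{ for }i=1,\dots,d\}$. Convention: rounding effects at the boundary are ignored, i.e. for $j\in\{j_0,\dots,J_*\}$ the blocks $U_{j,\mathbf{K}}$, $\mathbf{K}\in\mathcal{A}_j$, are regarded as covering $D_j$, so that $\sum_{\mathbf{k}\in D_j}$ is identified with $\sum_{\mathbf{K}\in\mathcal{A}_j}\sum_{\mathbf{k}\in U_{j,\mathbf{K}}}$. Estimator. For $\ell\in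 B_j$ and $\mathbf{k}\in D_j$ (with, when $j\in\{j_0,\dots,J_*\}$, $\mathbf{K}\in\mathcal{A}_j$ the index of the block such that $\mathbf{k}\in U_{j,\mathbf{K}}$), $$\widehat\theta^*_{j,\ell,\mathbf{k}}=\begin{cases} y_{j,\ell,\mathbf{k}}, & j\in\{0,\dots,j_0-1\},\\ y_{j,\ell,\mathbf{k}}\left(1-\dfrac{\lambda_*n^{-r}2^{\delta j}}{\frac{1}{L^d}\sum_{\mathbf{k}'\in U_{j,\mathbf{K}}}y_{j,\ell,\mathbf{k}'}^2}\right)_+, & j\in\{j_0,\dots,J_*\},\\ 0, & j\in\mathbb{N}\setminus\{0,\dots,J_*\},\end{cases}$$ with value $0$ in the second case if the block sum of squares vanishes. Risk. For a family $\theta=(\theta_{j,\ell,\mathbf{k}})_{j\ge 0,\ell\in B_j,\mathbf{k}\in D_j}$ of reals, $R(\widehat\theta,\theta)=\sum_{j=0}^\infty\sum_{\ell\in B_j}\sum_{\mathbf{k}\in D_j}\mathbb{E}\left((\widehat\theta_{j,\ell,\mathbf{k}}-\theta_{j,\ell,\mathbf{k}})^2\right)$. Smoothness space. $\boldsymbol{\Theta}^s_{p,q}(M)$ is the set of $\theta$ such that $$\left(\sum_{j=0}^\infty\sum_{\ell\in B_j}\left(2^{j(s+d_*/2-d_*/p)}\Big(\sum_{\mathbf{k}\in D_j}|\theta_{j,\ell,\mathbf{k}}|^p\Big)^{1/p}\right)^q\right)^{1/q}\le M,$$ with the usual supremum modifications if $p=\infty$ or $q=\infty$ (and $d_*/p=0$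 if $p=\infty$). *)

(* Defs.v *)
From HB Require Import structures.
From mathcomp Require Import all_boot all_order all_algebra.
From mathcomp Require Import all_classical all_reals all_analysis.

Set Implicit Arguments.
Unset Strict Implicit.
Unset Printing Implicit Defensive.

Import Order.TTheory GRing.Theory Num.Theory.
Import numFieldNormedType.Exports.
Local Open Scope classical_set_scope.
Local Open Scope ring_scope.

(* All floors below are floors of real numbers that are nonnegative (for n
   large enough), for which Num.truncn is the floor, with values in nat. *)

Definition log2 {R : realType} (x : R) : R := ln x / ln 2.

(* The index l in B_j = {1, ..., Bcard j} is represented by the ordinal
   l - 1 : 'I_(Bcard j). *)
Definition Bcard {R : realType} (cs ups : R) (j : nat) : nat :=
  Num.truncn (cs * 2 `^ (ups * j%:R)).

Definition Dcard {R : realType} {d : nat} (mu : 'I_d -> R) (j : nat) (i : 'I_d)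
  : nat := Num.truncn (2 `^ (mu i * j%:R)).

(* D_j, as a finite type: k i ranges over {0, ..., Dcard mu j i - 1}. *)
Definition Didx {R : realType} {d : nat} (mu : 'I_d -> R) (j : nat) : finType :=
  {dffun forall i : 'I_d, 'I_(Dcard mu j i)}.

Definition dstar {R : realType} {d : nat} (mu : 'I_d -> R) : R := \sum_i mu i.

(* J *)
Definition Jmax (R : realType) (n : nat) : nat := Num.truncn (log2 n%:R : R).

(* L *)
Definition blen {R : realType} (d : nat) (r : R) (n : nat) : nat :=
  Num.truncn ((r * ln n%:R) `^ d%:R^-1).

(* j_0; the infimum over the finite family mu is its minimum when 0 < d. *)
Definition jlow {R : realType} {d : nat} (mu : 'I_d -> R) (r : R) (n : nat)
  : nat := Num.truncn (1 / inf (range mu) * log2 (blen d r n)%:R).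

(* J_* *)
Definition jhigh {R : realType} {d : nat} (mu : 'I_d -> R) (ups delta r : R)
  (n : nat) : nat :=
  Num.truncn (r / (dstar mu + delta + ups) * log2 n%:R).

(* A_j, shifted by one: the block index K_i in {1, ..., floor(2^(mu_i j) / L)}
   is represented by the ordinal K_i - 1. *)
Definition Aidx {R : realType} {d : nat} (mu : 'I_d -> R) (r : R) (n j : nat)
  : finType :=
  {dffun forall i : 'I_d,
     'I_(Num.truncn (2 `^ (mu i * j%:R) * (blen d r n)%:R^-1))}.

(* U_{j,K} *)
Definition Ublock {R : realType} {d : nat} (mu : 'I_d -> R) (r : R) (n j : nat)
  (K : Aidx mu r n j) : {set Didx mu j} :=
  [set k : Didx mu j | [forall i : 'I_d,
     (K i * blen d r n <= k i < (K i).+1 * blen d r n)%N]]%SET.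

Definition block_sum {R : realType} {d : nat} (mu : 'I_d -> R) (r : R)
  (n j : nat) (F : Didx mu j -> \bar R) : \bar R :=
  (\sum_(K : Aidx mu r n j) \sum_(k in Ublock K) F k)%E.

(* The sum over k in D_j, under the convention that rounding effects at the
   boundary are ignored: at the scales j_0 <= j <= J_*, where blocks are used,
   the blocks are regarded as covering D_j and the sum over D_j is the double
   sum over the blocks and over the indices inside each block. *)
Definition scale_sum {R : realType} {d : nat} (mu : 'I_d -> R)
  (ups delta r : R) (n j : nat) (F : Didx mu j -> \bar R) : \bar R :=
  if (jlow mu r n <= j <= jhigh mu ups delta r n)%N
  then block_sum r n F
  else (\sum_(k : Didx mu j) F k)%E.

Definition array (R : realType) (d : nat) (cs ups : R) (mu : 'I_d -> R)
  (V : Type) : Type :=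
  forall j : nat, 'I_(Bcard cs ups j) -> Didx mu j -> V.

(* When j_0 <= j <= J_*, an index k lying in no block (which the rounding
   convention excludes, and which scale_sum ignores) gets the value 0. *)
Definition block_est {R : realType} {d : nat} {cs ups : R} {mu : 'I_d -> R}
  (r delta lambda : R) (n : nat) (y : array cs ups mu R) : array cs ups mu R :=
  fun j l k =>
  if (j < jlow mu r n)%N then y j l k
  else if (j <= jhigh mu ups delta r n)%N then
    if [pick K : Aidx mu r n j | k \in Ublock K] is Some K then
      let S := \sum_(k' in Ublock K) y j l k' ^+ 2 in
      if S == 0 then 0
      else y j l k *
        Num.max (1 - lambda * n%:R `^ (- r) * 2 `^ (delta * j%:R)
                     / (1 / (blen d r n)%:R ^+ d * S)) 0
    else 0
  else 0.

Arguments block_est {R d cs ups mu} r delta lambda n y j l k.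

Definition observation {R : realType} {d : nat} {cs ups : R} {mu : 'I_d -> R}
  (r : R) (n : nat) (theta zeta : array cs ups mu R) : array cs ups mu R :=
  fun j l k => theta j l k + n%:R `^ (- (r / 2)) * zeta j l k.
Arguments observation {R d cs ups mu} r n theta zeta j l k.

(* The noise is indexed by every scale j >= 0, because the estimator and (A2)
   involve the scales up to J_*, which exceeds J when r > d_* + delta + ups and
   n is large. *)
Definition noise_array {dT : measure_display} {T : measurableType dT}
  {R : realType} (P : probability T R) (d : nat) (cs ups : R)
  (mu : 'I_d -> R) : Type := array cs ups mu {RV P >-> R}.

Definition risk {dT : measure_display} {T : measurableType dT}
  {R : realType} {P : probability T R} {d : nat} {cs ups : R} {mu : 'I_d -> R}
  (r delta lambda : R) (n : nat) (z : noise_array P cs ups mu)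
  (theta : array cs ups mu R) : \bar R :=
  (\sum_(0 <= j <oo) \sum_(l < Bcard cs ups j)
     scale_sum ups delta r n (fun k : Didx mu j =>
       'E_P[fun w => ((block_est r delta lambda n
               (observation r n theta (fun j l k => z j l k w)) j l k
             - theta j l k) ^+ 2)%R]))%E.

(* At the scales j_0 <= j <= J_*, scale_sum ranges over a subset of D_j, so this
   is implied by the same bound with the sum over the whole of D_j. *)
Definition assumption_A1 {dT : measure_display} {T : measurableType dT}
  {R : realType} {P : probability T R} {d : nat} {cs ups : R} {mu : 'I_d -> R}
  (r delta Q1 : R) (n : nat) (z : noise_array P cs ups mu) : Prop :=
  forall (j : nat) (l : 'I_(Bcard cs ups j)), (j <= Jmax R n)%N ->
    ((2 `^ (- (j%:R * (dstar mu + delta))))%R%:E *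
     scale_sum ups delta r n (fun k : Didx mu j =>
       'E_P[fun w => ((z j l k w) ^+ 2)%R]) <= Q1%:E)%E.

Definition assumption_A2 {dT : measure_display} {T : measurableType dT}
  {R : realType} {P : probability T R} {d : nat} {cs ups : R} {mu : 'I_d -> R}
  (r delta lambda Q2 : R) (n : nat) (z : noise_array P cs ups mu) : Prop :=
  (\sum_(jlow mu r n <= j < (jhigh mu ups delta r n).+1)
   \sum_(l < Bcard cs ups j)
   \sum_(K : Aidx mu r n j) \sum_(k in Ublock K)
     'E_P[fun w => ((z j l k w) ^+ 2 *
        \1_[set w' | \sum_(k' in Ublock K) (z j l k' w') ^+ 2 >
             lambda * 2 `^ (delta * j%:R) * (blen d r n)%:R ^+ d / 4] w)%R]
   <= Q2%:E)%E.

(* The exponents p and q range over ]0, +oo]; the values at -oo are junk. *)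

Definition inv_exponent {R : realType} (p : \bar R) : R :=
  if p is p'%:E then p'^-1 else 0.

Definition lp_norm {R : realType} {I : finType} (p : \bar R) (x : I -> R) : R :=
  match p with
  | p'%:E => (\sum_i `|x i| `^ p') `^ p'^-1
  | +oo%E => \big[Num.max/0]_i `|x i|
  | -oo%E => 0
  end.

(* Here the sums are over the whole of D_j, so that the smoothness ball does not
   depend on n. The supremum of the risk over the ball is unaffected by this:
   the risk does not involve the coefficients lying in no block, which can be
   set to 0. *)
Definition smooth_norm {R : realType} {d : nat} {cs ups : R} {mu : 'I_d -> R}
  (s : R) (p q : \bar R) (theta : array cs ups mu R) : \bar R :=
  let a j l := 2 `^ (j%:R * (s + dstar mu / 2 - dstar mu * inv_exponent p))
               * lp_norm p (theta j l) in
  match q with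
  | q'%:E => ((\sum_(0 <= j <oo) \sum_(l < Bcard cs ups j)
                 (a j l `^ q')%R%:E) `^ (q'^-1)%R)%E
  | +oo%E => ereal_sup [set x | exists j l, x = (a j l)%:E]
  | -oo%E => 0%E
  end.

Definition smooth_ball {R : realType} {d : nat} {cs ups : R} {mu : 'I_d -> R}
  (s : R) (p q : \bar R) (M : R) : set (array cs ups mu R) :=
  [set theta | (smooth_norm s p q theta <= M%:E)%E].

Definition max_risk {dT : measure_display} {T : measurableType dT}
  {R : realType} {P : probability T R} {d : nat} {cs ups : R} {mu : 'I_d -> R}
  (r delta lambda s : R) (p q : \bar R) (M : R) (n : nat)
  (z : noise_array P cs ups mu) : \bar R :=
  ereal_sup [set risk r delta lambda n z theta | theta in smooth_ball s p q M].

Definition bounded_by_rate {R : realType} (u : nat -> \bar R) (rho : nat -> R)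
  : Prop :=
  exists2 C : R, 0 < C & \forall n \near \oo, (u n <= (C * rho n)%:E)%E.

(* Main.v *)
Require Import Defs.
From HB Require Import structures.
From mathcomp Require Import all_boot all_order all_algebra.
From mathcomp Require Import all_classical all_reals all_analysis.
From mathcomp Require Import measurable_realfun.
From mathcomp Require Import lra ring.

Set Implicit Arguments.
Unset Strict Implicit.
Unset Printing Implicit Defensive.

Import Order.TTheory GRing.Theory Num.Theory.
Import numFieldNormedType.Exports.
Local Open Scope classical_set_scope.
Local Open Scope ring_scope.

(** The shrinkage of a block with signal energy [Th], noise energy [N] and
    threshold [t] costs at most [10 (min Th t + N 1_{N > t/4})]; (A2) bounds the
    sum of the noise terms by [Q2 n^-r], so (A1) is needed only at the scales
    below [j_0].  What remains is deterministic.  Write [G = d_* + delta + ups]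
    and [D = 2 s + G], and cut the scales at [x] with [2^x = n^(r/D)] when
    [p >= 2] and [2^x = (n / ln n)^(r/D)] when [p < 2].  At the scales [j <= x]
    the thresholds (or the variances, below [j_0]) add up to
    [O(n^-r 2^(G x))].  At the scales [j > x], one bounds [min Th t] by [Th] when
    [p >= 2] and by [t^(1-p/2) Th^(p/2)] when [p < 2], which turns the smoothness
    norm into a geometrically decreasing bound.  When [ups = 0] there are at most
    [c_*] levels [l] per scale, which replaces the condition [q <= min(p, 2)]. *)

(** * Superadditivity of the integral of nonnegative functions *)

(* The integral of a nonnegative function is a supremum over simple functions
   below it, hence superadditive without measurability: the estimator need not
   be shown measurable. *)
Section lower_integral.
Context d (T : measurableType d) (R : realType) (mu : {measure set T -> \bar R}).
Local Open Scope ereal_scope.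

Import HBNNSimple.

Lemma ge0_le_integralT (f g : T -> \bar R) :
  (forall x, 0 <= f x) -> (forall x, f x <= g x) ->
  \int[mu]_x f x <= \int[mu]_x g x.
Proof.
move=> f0 fg; rewrite !ge0_integralTE//; last first.
  by move=> x; exact: le_trans (f0 x) (fg x).
apply: le_ereal_sup => _ /= [h hf <-]; exists h => // x.
exact: le_trans (hf x) (fg x).
Qed.

Lemma ge0_integral_superD (f g : T -> \bar R) :
  (forall x, 0 <= f x) -> (forall x, 0 <= g x) ->
  \int[mu]_x f x + \int[mu]_x g x <= \int[mu]_x (f x + g x).
Proof.
move=> f0 g0.
have fg0 x : 0 <= f x + g x by rewrite adde_ge0.
have If : \int[mu]_x f x <= \int[mu]_x (f x + g x).
  by apply: ge0_le_integralT => // x; rewrite leeDl.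
have Ig : \int[mu]_x g x <= \int[mu]_x (f x + g x).
  by apply: ge0_le_integralT => // x; rewrite leeDr.
(* If the right-hand side is infinite there is nothing to prove. Otherwise every integral is finite,
   so one term at a time can be moved across the inequality and replaced by a simple function below
   it. *)
have [->|Ify] := eqVneq (\int[mu]_x (f x + g x)) +oo; first by rewrite leey.
have finP (a : \bar R) : 0 <= a -> a <= \int[mu]_x (f x + g x) ->
    a \is a fin_num.
  move=> a0 aI; rewrite ge0_fin_numE//; apply: le_lt_trans aI _.
  by rewrite lt_neqAle Ify leey.
have Ifin : \int[mu]_x f x \is a fin_num by apply: finP => //; exact: integral_ge0.
rewrite addeC -leeBrDr// [X in X <= _]ge0_integralTE//.
apply: ge_ereal_sup => _ /= [h2 h2g <-].
have h2I : sintegral mu h2 <= \int[mu]_x g x.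
  by rewrite ge0_integralTE//; apply: ereal_sup_ubound; exists h2.
have h2fin : sintegral mu h2 \is a fin_num.
  by apply: finP; [exact: sintegral_ge0|exact: le_trans Ig].
rewrite leeBrDr// addeC -leeBrDr// [X in X <= _]ge0_integralTE//.
apply: ge_ereal_sup => _ /= [h1 h1f <-].
rewrite leeBrDr// -sintegralD ge0_integralTE//.
apply: ereal_sup_ubound; exists (add_nnsfun h1 h2) => //= x.
by rewrite EFinD leeD.
Qed.

Lemma ge0_integral_super_sum (I : Type) (s : seq I) (Q : pred I)
    (f : I -> T -> \bar R) : (forall i x, 0 <= f i x) ->
  \sum_(i <- s | Q i) \int[mu]_x f i x <= \int[mu]_x \sum_(i <- s | Q i) f i x.
Proof.
move=> f0; elim: s => [|i s IH].
  by rewrite big_nil integral_ge0// => x _; rewrite big_nil.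
under eq_integral do rewrite big_cons; rewrite big_cons; case: ifP => // Qi.
apply: (le_trans _ (ge0_integral_superD _ _)) => //.
  by rewrite leeD2l.
by move=> x; apply: sume_ge0 => j _.
Qed.

End lower_integral.

(** * Real powers, geometric sums, and logarithms against powers *)

Section powers.
Context {R : realType}.
Implicit Types a b t u x y : R.

(** The embedding of l^p in l^m with constant 1: the hypothesis forces every [b i <= K], hence
    [b i ^ m <= b i ^ p * K ^ (m - p)]. *)
Lemma sum_powR_le (I : Type) (s : seq I) (Q : pred I) (b : I -> R) (p m K : R) :
  0 < p -> p <= m -> 0 <= K -> (forall i, 0 <= b i) ->
  \sum_(i <- s | Q i) b i `^ p <= K `^ p ->
  \sum_(i <- s | Q i) b i `^ m <= K `^ m.
Proof.
move=> p0 pm K0 b0 hK.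
have m0 : 0 < m by exact: lt_le_trans pm.
have split_powR x : x `^ m = x `^ p * x `^ (m - p).
  have [<-|npm] := eqVneq p m; first by rewrite subrr powRr0 mulr1.
  rewrite -powRD; first by rewrite addrC subrK.
  by rewrite addrC subrK (gt_eqF m0).
have [Kz|Kz] := eqVneq K 0.
  rewrite Kz powR0 ?gt_eqF//.
  rewrite Kz powR0 ?gt_eqF// in hK.
  elim: s hK => [|i s IH]; rewrite ?big_nil// !big_cons; case: ifP => // _ hK.
  have S0 : 0 <= \sum_(j <- s | Q j) b j `^ p by apply: sumr_ge0 => *; exact: powR_ge0.
  have bp0 := powR_ge0 (b i) p.
  have : b i `^ p == 0 by rewrite eq_le bp0 andbT; lra.
  rewrite powR_eq0 => /andP[/eqP -> _]; rewrite powR0 ?gt_eqF// add0r.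
  by apply: IH; lra.
rewrite (split_powR K); apply: (@le_trans _ _
    (\sum_(i <- s | Q i) b i `^ p * K `^ (m - p))); last first.
  by rewrite -mulr_suml ler_wpM2r ?powR_ge0.
have bK : forall i, List.In i s -> Q i -> b i <= K.
  move=> i; elim: s hK => // j s IH; rewrite big_cons /=.
  have S0 : 0 <= \sum_(j <- s | Q j) b j `^ p by apply: sumr_ge0 => *; exact: powR_ge0.
  case: ifP => Qj hK; last by case=> [<-|]; [rewrite Qj|exact: IH].
  have bj := powR_ge0 (b j) p.
  case=> [<- _|]; last by apply: IH; lra.
  have : b j `^ p <= K `^ p by lra.
  rewrite leNgt => /negP h; rewrite leNgt; apply/negP => Kb; apply: h.
  by rewrite gt0_ltr_powR ?nnegrE.
elim: s bK {hK} => [|i s IH] bK; first by rewrite !big_nil.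
rewrite !big_cons; case: ifP => Qi; last by apply: IH => j js; apply: bK; right.
apply: lerD; last by apply: IH => j js; apply: bK; right.
rewrite split_powR ler_wpM2l ?powR_ge0// ge0_ler_powR ?nnegrE ?subr_ge0//.
by apply: bK => //; left.
Qed.

(** The minimum is the product of its own powers [1 - a] and [a]; bound the first factor by means of
    [t] and the second by means of [u]. *)
Lemma min_le_powR (a t u : R) : 0 <= u -> 0 < t -> 0 < a <= 1 ->
  Num.min u t <= t `^ (1 - a) * u `^ a.
Proof.
move=> u0 t0 /andP[a0 a1].
have [->|uN0] := eqVneq u 0.
  by rewrite powR0 ?gt_eqF// mulr0 ge_min lexx.
have {u0 uN0} u0 : 0 < u by rewrite lt_neqAle eq_sym uN0.
have s1 x : 0 < x -> x = x `^ (1 - a) * x `^ a.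
  move=> x0; rewrite -powRD; last by rewrite (gt_eqF x0) implybT.
  by rewrite subrK powRr1// ltW.
have [ut|tu] := leP u t.
  by rewrite {1}(s1 u)// ler_wpM2r ?powR_ge0// ge0_ler_powR ?nnegrE ?subr_ge0// ltW.
by rewrite {1}(s1 t)// ler_wpM2l ?powR_ge0// ge0_ler_powR ?nnegrE ?(ltW u0) ?(ltW t0) ?(ltW a0) ?(ltW tu).
Qed.

Lemma gt0_powRD a x y : 0 < a -> a `^ (x + y) = a `^ x * a `^ y.
Proof. by move=> a0; rewrite powRD// (gt_eqF a0) implybT. Qed.

Lemma powR_sqr a x : (a `^ x) ^+ 2 = a `^ (x * 2).
Proof. by rewrite -powR_mulrn ?powR_ge0// -powRrM. Qed.

Lemma powR_log2 x a : 0 < x -> 2 `^ (a * log2 x) = x `^ a.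
Proof.
have l2 : ln 2 != 0 :> R by rewrite gt_eqF// ln_gt0// ltr1n.
by move=> x0; rewrite /log2 /powR !gt_eqF//; congr expR; field.
Qed.

Lemma gt1_powR2 a : 0 < a -> 1 < 2 `^ a :> R.
Proof.
by move=> a0; rewrite /powR gt_eqF// -[ltLHS]expR0 ltr_expR mulr_gt0// ln_gt0// ltr1n.
Qed.

Lemma le_powR2 a b : a <= b -> 2 `^ a <= 2 `^ b :> R.
Proof. by move=> ab; rewrite ler_powR// ler1n. Qed.

(* Telescoping: the summand is at most [h j.+1 - h j], up to the factor
   [2 `^ a - 1], for [h j = min (2 `^ (a * j)) (2 `^ (a * (x + 1)))]. *)
Lemma geometric_below (a x : R) (N : nat) : 0 < a ->
  \sum_(0 <= j < N) (if j%:R <= x then 2 `^ (a * j%:R) else 0)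
    <= 2 `^ a / (2 `^ a - 1) * 2 `^ (a * x).
Proof.
move=> a0; have c0 : 0 < 2 `^ a - 1 :> R by rewrite subr_gt0 gt1_powR2.
pose h (j : nat) : R := Num.min (2 `^ (a * j%:R)) (2 `^ (a * (x + 1))).
have step (j : nat) : (2 `^ a - 1) * (if j%:R <= x then 2 `^ (a * j%:R) else 0)
    <= h j.+1 - h j.
  have hS : 2 `^ (a * j.+1%:R) = 2 `^ a * 2 `^ (a * j%:R) :> R.
    by rewrite -gt0_powRD//; congr (_ `^ _); rewrite -natr1; ring.
  have pj : 0 < 2 `^ (a * j%:R) :> R by exact: powR_gt0.
  rewrite /h; case: ifP => [jx|_].
    have le1 : 2 `^ (a * j.+1%:R) <= 2 `^ (a * (x + 1)) :> R.
      by apply: le_powR2; rewrite ler_pM2l// -natr1 lerD2r.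
    by rewrite hS in le1 *; rewrite !min_l//; nra.
  rewrite mulr0 subr_ge0 le_min !ge_min hS lexx orbT andbT.
  by apply/orP; left; nra.
rewrite [leRHS](_ : _ = (2 `^ (a * (x + 1))) / (2 `^ a - 1)); last first.
  by rewrite mulrDr mulr1 gt0_powRD//; ring.
rewrite ler_pdivlMr// mulrC mulr_sumr.
apply: (@le_trans _ _ (\sum_(0 <= j < N) (h j.+1 - h j))).
  by apply: ler_sum => j _; exact: step.
rewrite telescope_sumr//.
have h0 : 0 <= h 0%N by rewrite /h le_min !powR_ge0.
have hN : h N <= 2 `^ (a * (x + 1)) by rewrite /h ge_min lexx orbT.
lra.
Qed.

(** Telescoping again, now with the decreasing [h j = min (2 ^ (- a j)) (2 ^ (- a x))]: for [j > x]
    the minimum is its first entry, and the cap at [2 ^ (- a x)] bounds [h 0]. The bound is uniform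
    in [N], so it passes to the series. *)
Lemma geometric_above (a x : R) (N : nat) : 0 < a ->
  \sum_(0 <= j < N) (if x < j%:R then 2 `^ (- (a * j%:R)) else 0)
    <= (1 - 2 `^ (- a))^-1 * 2 `^ (- (a * x)).
Proof.
move=> a0.
have c1 : 0 < 2 `^ (-a) :> R by exact: powR_gt0.
have c0 : 0 < 1 - 2 `^ (-a) :> R.
  by rewrite subr_gt0 powRN invf_lt1 ?gt1_powR2 ?powR_gt0.
pose h (j : nat) : R := Num.min (2 `^ (- (a * j%:R))) (2 `^ (- (a * x))).
have step (j : nat) : (1 - 2 `^ (-a)) * (if x < j%:R then 2 `^ (- (a * j%:R)) else 0)
    <= h j - h j.+1.
  have hS : 2 `^ (- (a * j.+1%:R)) = 2 `^ (-a) * 2 `^ (- (a * j%:R)) :> R.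
    by rewrite -gt0_powRD//; congr (_ `^ _); rewrite -natr1; ring.
  have pj : 0 < 2 `^ (- (a * j%:R)) :> R by exact: powR_gt0.
  rewrite /h; case: ifP => [jx|_].
    have le1 : 2 `^ (- (a * j%:R)) <= 2 `^ (- (a * x)) :> R.
      by apply: le_powR2; rewrite lerN2 ler_pM2l// ltW.
    by rewrite hS !min_l//; nra.
  rewrite mulr0 subr_ge0 le_min !ge_min hS lexx orbT andbT.
  by apply/orP; left; nra.
rewrite mulrC ler_pdivlMr// mulrC mulr_sumr.
apply: (@le_trans _ _ (\sum_(0 <= j < N) - (h j.+1 - h j))).
  by apply: ler_sum => j _; rewrite opprB; exact: step.
rewrite sumrN telescope_sumr//.
have h0 : 0 <= h N by rewrite /h le_min !powR_ge0.
have hN : h 0%N <= 2 `^ (- (a * x)) by rewrite /h ge_min lexx orbT.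
lra.
Qed.

(** Apply [ln u < u] to [u = n ^ (b / 2)]; the other factor [n ^ (b / 2)] eventually exceeds the
    constant [c * (2 / b)]. *)
Lemma near_ln_le_powR (c b : R) : 0 < c -> 0 < b ->
  \forall n \near \oo, c * ln (n%:R : R) <= n%:R `^ b.
Proof.
move=> c0 b0.
have cb0 : 0 < c * (2 / b) by rewrite mulr_gt0// divr_gt0.
near=> n.
have n0 : 0 < (n%:R : R) by rewrite ltr0n; near: n; exact: nbhs_infty_gt.
have hn : c * (2 / b) <= n%:R `^ (b / 2).
  rewrite [leLHS](_ : _ = ((c * (2 / b)) `^ (2 / b)) `^ (b / 2)); last first.
    by rewrite -powRrM (_ : 2 / b * (b / 2) = 1) ?powRr1 ?ltW//; field; rewrite gt_eqF.
  rewrite ge0_ler_powR ?nnegrE ?powR_ge0 ?divr_ge0 ?(ltW b0)//.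
  by near: n; exact: nbhs_infty_ger.
have l1 : ln (n%:R `^ (b / 2)) < n%:R `^ (b / 2) :> R.
  by apply: ln_sublinear; rewrite powR_gt0.
rewrite ln_powR in l1.
have -> : n%:R `^ b = n%:R `^ (b / 2) * n%:R `^ (b / 2) :> R.
  by rewrite -gt0_powRD//; congr (_ `^ _); lra.
apply: (@le_trans _ _ ((c * (2 / b)) * n%:R `^ (b / 2))); last first.
  by rewrite ler_wpM2r ?powR_ge0.
rewrite -mulrA ler_wpM2l ?(ltW c0)//.
have -> : ln (n%:R : R) = 2 / b * (b / 2 * ln n%:R) by field; rewrite gt_eqF.
by rewrite ler_wpM2l ?divr_ge0 ?(ltW b0) ?(ltW l1).
Unshelve. all: by end_near. Qed.

End powers.

(** * Deterministic oracle inequality on one block *)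

Section block_shrinkage.
Context {R : realType} {I : finType} (U : {set I}) (theta zeta : I -> R) (t : R).

(** When [N <= t / 4], the observed energy [S] reveals on which side of a multiple of [t] the signal
    energy lies: [S <= t] forces [Th <= 5 t / 2] and [S > t] forces [Th > t / 4]. When [N > t / 4],
    both possible losses are multiples of [N]. *)
Lemma block_oracle (est : I -> R)
    (S := \sum_(k in U) (theta k + zeta k) ^+ 2)
    (N := \sum_(k in U) zeta k ^+ 2) (Th := \sum_(k in U) theta k ^+ 2) :
  0 < t ->
  (forall k, k \in U -> est k = if S == 0 then 0 else
     (theta k + zeta k) * Num.max (1 - t / S) 0) ->
  \sum_(k in U) (est k - theta k) ^+ 2
    <= 10 * (Num.min Th t + (if t / 4 < N then N else 0)).
Proof.
move=> t0 estE.
have N0 : 0 <= N by apply: sumr_ge0 => *; exact: sqr_ge0.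
have T0 : 0 <= Th by apply: sumr_ge0 => *; exact: sqr_ge0.
have S0 : 0 <= S by apply: sumr_ge0 => *; exact: sqr_ge0.
have sum2 (f g h : I -> R) (c : R) :
    (forall k, f k <= 2 * g k + c * h k) ->
    \sum_(k in U) f k <= 2 * \sum_(k in U) g k + c * \sum_(k in U) h k.
  by move=> fgh; rewrite !mulr_sumr -big_split; apply: ler_sum => k _; exact: fgh.
have Th_le : Th <= 2 * S + 2 * N.
  apply: sum2 => k; have := sqr_ge0 (theta k + 2 * zeta k); nra.
have S_le : S <= 2 * Th + 2 * N.
  apply: sum2 => k; have := sqr_ge0 (theta k - zeta k); nra.
(* Here the whole block is set to 0 and the loss is [Th <= 2 S + 2 N]: at most [5 t / 2] for small
   noise, at most [10 N] when [t < 4 N]. *)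
have [St|tS] := leP S t.
  have -> : \sum_(k in U) (est k - theta k) ^+ 2 = Th.
    apply: eq_bigr => k kU; rewrite estE//; case: eqVneq => [_|SN0].
      by rewrite sub0r sqrrN.
    have Sgt0 : 0 < S by rewrite lt_neqAle eq_sym SN0.
    rewrite max_r ?mulr0 ?sub0r ?sqrrN// subr_le0.
    by rewrite ler_pdivlMr// mul1r.
  case: ltP => hN; last by rewrite addr0 /Num.min; case: ltP => _; lra.
  have m0 : 0 <= Num.min Th t by rewrite le_min T0 ltW.
  lra.
have Sgt0 : 0 < S by exact: lt_trans tS.
(* The error in each coordinate is the noise minus [t / S] times the observation, and
   [(t / S) ^ 2 * S <= t]. The constant 10 comes from here: for small noise the loss is at most
   [5 t / 2] while [t < 4 Th]; otherwise it is at most [2 N + 2 t < 10 N]. *)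
have E_le : \sum_(k in U) (est k - theta k) ^+ 2 <= 2 * N + 2 * t.
  apply: (@le_trans _ _ (2 * N + 2 * (t / S) ^+ 2 * S)); last first.
    rewrite lerD2l (_ : _ * S = 2 * (t * (t / S))); last by field; rewrite gt_eqF.
  by rewrite ler_pM2l// ler_piMr ?(ltW t0)// ler_pdivrMr// mul1r ltW.
  rewrite (_ : \sum_(k in U) _ =
      \sum_(k in U) (zeta k - t / S * (theta k + zeta k)) ^+ 2); last first.
    apply: eq_bigr => k kU; rewrite estE// gt_eqF// max_l.
      by congr (_ ^+ 2); ring.
    by rewrite subr_ge0 ler_pdivrMr// mul1r ltW.
  apply: sum2 => k.
  have := sqr_ge0 (zeta k + t / S * (theta k + zeta k)).
  set c := t / S; nra.
case: ltP => hN; last by rewrite addr0 /Num.min; case: ltP => _; lra.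
have m0 : 0 <= Num.min Th t by rewrite le_min T0 ltW.
lra.
Qed.

End block_shrinkage.

(** * Combinatorics of the blocks and the three regimes of the estimator *)

Section blocks.
Context {R : realType} {d : nat} (mu : 'I_d -> R).

(** Each [K i] is the Euclidean quotient of [k i] by the block length; blocks of length 0 are
    empty. *)
Lemma Ublock_inj (r : R) n j (K K' : Aidx mu r n j) (k : Didx mu j) :
  k \in Ublock K -> k \in Ublock K' -> K = K'.
Proof.
have key (a b x L : nat) : (a * L <= x < a.+1 * L)%N ->
    (b * L <= x < b.+1 * L)%N -> a = b.
  case: L => [|L]; first by rewrite !muln0 ltn0 andbF.
  move=> /andP[a1 a2] /andP[b1 b2].
  have := leq_ltn_trans a1 b2; have := leq_ltn_trans b1 a2.
  by rewrite !ltn_pmul2r// !ltnS => h1 h2; apply/eqP; rewrite eqn_leq h1 h2.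
rewrite !inE => /forallP kK /forallP kK'; apply/ffunP => i; apply: val_inj.
exact: key (kK i) (kK' i).
Qed.

(** After exchanging the sums, each [k] is counted at most once because the blocks are disjoint;
    indices near the boundary of [D_j] may lie in no block. *)
Lemma sum_Ublock_le (r : R) n j (f : Didx mu j -> R) : (forall k, 0 <= f k) ->
  \sum_(K : Aidx mu r n j) \sum_(k in Ublock K) f k <= \sum_k f k.
Proof.
move=> f0; under eq_bigr do rewrite big_mkcond.
rewrite exchange_big /=; apply: ler_sum => k _.
have [[K kK]|noK] := pselect (exists K : Aidx mu r n j, k \in Ublock K).
  rewrite (bigD1 K)//= kK big1 ?addr0// => K' K'K.
  by case: ifP => // kK'; rewrite (Ublock_inj kK kK') eqxx in K'K.
rewrite big1// => K _; case: ifP => // kK.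
by case: noK; exists K.
Qed.

Lemma powR_sum (I : finType) (a : R) (f : I -> R) : 0 < a ->
  a `^ (\sum_i f i) = \prod_i a `^ f i.
Proof.
move=> a0; elim/big_rec2: _ => [|i x y _ ih]; first by rewrite powRr0.
by rewrite gt0_powRD// ih.
Qed.

Lemma card_dffun_ord_le (m : 'I_d -> nat) (e : 'I_d -> R) :
  (forall i, (m i)%:R <= e i) ->
  (#|{dffun forall i : 'I_d, 'I_(m i)}|%:R : R) <= \prod_i e i.
Proof.
move=> me; rewrite card_dep_ffun foldrE big_map big_enum/= natr_prod.
by apply: ler_prod => i _; rewrite ler0n card_ord me.
Qed.

Lemma card_Didx_le j : (#|Didx mu j|%:R : R) <= 2 `^ (dstar mu * j%:R).
Proof.
rewrite /dstar mulr_suml powR_sum//; apply: card_dffun_ord_le => i.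
by rewrite truncn_le powR_ge0.
Qed.

(** The factor [L ^ d] of a block threshold is compensated by the number of blocks, so the
    thresholds of a level add up without a logarithm. *)
Lemma card_Aidx_le (r : R) n j : (0 < blen d r n)%N ->
  (#|Aidx mu r n j|%:R : R) * (blen d r n)%:R ^+ d <= 2 `^ (dstar mu * j%:R).
Proof.
move=> L0; have LR : 0 < (blen d r n)%:R :> R by rewrite ltr0n.
rewrite -ler_pdivlMr ?exprn_gt0//.
apply: (@le_trans _ _ (\prod_(i < d) (2 `^ (mu i * j%:R) * (blen d r n)%:R^-1))).
  apply: card_dffun_ord_le => i.
  by rewrite truncn_le mulr_ge0 ?powR_ge0// invr_ge0 ltW.
rewrite big_split/= -powR_sum// -mulr_suml prodr_const card_ord exprVn//.
Qed.

Context {cs ups : R}.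

Lemma block_est_coarse (r delta lambda : R) n (y : array cs ups mu R) j l k :
  (j < jlow mu r n)%N -> block_est r delta lambda n y j l k = y j l k.
Proof. by rewrite /block_est => ->. Qed.

Lemma block_est_fine (r delta lambda : R) n (y : array cs ups mu R) j l k :
  (jlow mu r n <= j)%N -> (jhigh mu ups delta r n < j)%N ->
  block_est r delta lambda n y j l k = 0.
Proof. by move=> jl jh; rewrite /block_est ltnNge jl /= leqNgt jh. Qed.

Lemma block_est_Ublock (r delta lambda : R) n (y : array cs ups mu R) j l
    (K : Aidx mu r n j) k
    (S := \sum_(k' in Ublock K) y j l k' ^+ 2) :
  (jlow mu r n <= j <= jhigh mu ups delta r n)%N -> k \in Ublock K ->
  block_est r delta lambda n y j l k = if S == 0 then 0 else
    y j l k * Num.max (1 -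
      lambda * n%:R `^ (- r) * 2 `^ (delta * j%:R) * (blen d r n)%:R ^+ d / S) 0.
Proof.
move=> /andP[j1 j2] kK; rewrite /block_est ltnNge j1 /= j2.
(* The block returned by [pick] contains [k], hence equals [K] by disjointness. *)
case: pickP => [K' kK'|/(_ K)]; last by rewrite kK.
rewrite (Ublock_inj kK' kK) -/S; case: ifP => // _.
by rewrite div1r invfM invrK mulrA.
Qed.

End blocks.

(** * Risk below, within and above the range of block scales *)

Section scale_risk.
Context {dT : measure_display} {T : measurableType dT} {R : realType}
  {P : probability T R} {d : nat} {cs ups : R} {mu : 'I_d -> R}.
Context (r delta lambda : R) (n : nat) (z : noise_array P cs ups mu)
  (theta : array cs ups mu R).
Hypotheses (n0 : (0 < n)%N) (lambda0 : 0 < lambda).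

Arguments z : clear implicits.
Arguments theta : clear implicits.

Local Notation sq_error j l k := (fun w => ((block_est r delta lambda n
  (observation r n theta (fun j l k => z j l k w)) j l k - theta j l k) ^+ 2)%R).

Let noise_var_gt0 : 0 < n%:R `^ (- r) :> R.
Proof. by rewrite powR_gt0// ltr0n. Qed.

Let noise_varE : (n%:R `^ (- (r / 2))) ^+ 2 = n%:R `^ (- r) :> R.
Proof. by rewrite powR_sqr; congr (_ `^ _); lra. Qed.

Lemma risk_coarse j (l : 'I_(Bcard cs ups j)) : (j < jlow mu r n)%N ->
  (\sum_k 'E_P[sq_error j l k] =
   (n%:R `^ (- r))%:E * \sum_k 'E_P[fun w => ((z j l k w) ^+ 2)%R])%E.
Proof.
move=> jl; rewrite ge0_sume_distrr; last first.
  by move=> k _; apply: expectation_ge0 => w; exact: sqr_ge0.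
apply: eq_bigr => k _; rewrite unlock -ge0_integralZl_EFin//; last 2 first.
- by move=> w _; rewrite lee_fin sqr_ge0.
- by apply/measurable_EFinP/measurable_funX; exact: measurable_funPT.
apply: eq_integral => w _; rewrite -EFinM; congr EFin.
by rewrite block_est_coarse// /observation addrAC subrr add0r exprMn noise_varE.
Qed.

Lemma risk_fine j (l : 'I_(Bcard cs ups j)) : (jlow mu r n <= j)%N -> (jhigh mu ups delta r n < j)%N ->
  (\sum_k 'E_P[sq_error j l k] = (\sum_k theta j l k ^+ 2)%:E)%E.
Proof.
move=> jl jh; rewrite -sumEFin; apply: eq_bigr => k _.
rewrite -(expectation_cst P); congr expectation; apply/funext => w.
by rewrite block_est_fine// sub0r sqrrN.
Qed.

(** Integrate [block_oracle], which holds for every outcome [w], with noise [n ^ (- r / 2) * z].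
    Dividing the condition [N > t / 4] by [n ^ (- r)] turns it into the event of (A2). *)
Lemma risk_block j (l : 'I_(Bcard cs ups j)) (K : Aidx mu r n j)
    (t := lambda * n%:R `^ (- r) * 2 `^ (delta * j%:R) * (blen d r n)%:R ^+ d) :
  (0 < blen d r n)%N -> (jlow mu r n <= j <= jhigh mu ups delta r n)%N ->
  (\sum_(k in Ublock K) 'E_P[sq_error j l k] <=
   (10 * Num.min (\sum_(k in Ublock K) theta j l k ^+ 2) t)%:E +
   (10 * n%:R `^ (- r))%:E * \sum_(k in Ublock K)
     'E_P[fun w => ((z j l k w) ^+ 2 *
        \1_[set w' | \sum_(k' in Ublock K) (z j l k' w') ^+ 2 >
             lambda * 2 `^ (delta * j%:R) * (blen d r n)%:R ^+ d / 4] w)%R])%E.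
Proof.
move=> L0 jj; set bad := [set w' | _]; set m := Num.min _ t.
have mz k : measurable_fun setT (z j l k) by exact: measurable_funPT.
have mbad : measurable bad.
  have mS : measurable_fun setT (fun w => \sum_(k in Ublock K) z j l k w ^+ 2).
    under eq_fun do rewrite big_mkcond; apply: measurable_sum => k.
    by case: (k \in Ublock K) => //; exact: measurable_funX.
  have := mS measurableT _ (measurable_itv
    `]lambda * 2 `^ (delta * j%:R) * (blen d r n)%:R ^+ d / 4, +oo[).
  rewrite setTI; congr measurable; apply/seteqP.
  by split=> w; rewrite /bad /= in_itv /= andbT.
have LR : 0 < (blen d r n)%:R ^+ d :> R by rewrite exprn_gt0 ?ltr0n.
have t0 : 0 < t by rewrite /t !mulr_gt0// powR_gt0.
have m0 : 0 <= m by rewrite le_min (ltW t0) andbT sumr_ge0// => k _; exact: sqr_ge0.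
pose tail k w := (z j l k w) ^+ 2 * \1_bad w.
have tail0 k w : 0 <= tail k w by rewrite /tail mulr_ge0 ?sqr_ge0.
have mtail k : measurable_fun setT (EFin \o tail k).
  apply/measurable_EFinP/measurable_funM; first exact: measurable_funX.
  exact: measurable_indic.
have msum : measurable_fun setT (fun w => \sum_(k in Ublock K) (tail k w)%:E)%E.
  under eq_fun do rewrite big_mkcond; apply: emeasurable_sum => k.
  by case: (k \in Ublock K) => //; exact: mtail.
have c0 : 0 <= 10 * n%:R `^ (- r) :> R by rewrite mulr_ge0// ltW.
have -> : ((10 * n%:R `^ (- r))%:E * \sum_(k in Ublock K)
     'E_P[tail k] = \int[P]_w ((10 * n%:R `^ (- r))%:E *
       \sum_(k in Ublock K) (tail k w)%:E))%E.
  rewrite ge0_integralZl_EFin//; last first.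
    by move=> w _; apply: sume_ge0 => k _; rewrite lee_fin.
  congr (_ * _)%E; under [RHS]eq_integral do rewrite big_mkcond.
  rewrite ge0_integral_sum//; last 2 first.
  - by move=> k; case: (k \in Ublock K) => //; exact: mtail.
  - by move=> k w _; case: (k \in Ublock K) => //; rewrite lee_fin.
  rewrite big_mkcond; apply: eq_bigr => k _.
  case: (k \in Ublock K); last by rewrite integral0.
  by rewrite unlock.
have -> : (10 * m)%:E = (\int[P]_w (10 * m)%:E)%E.
  by rewrite -[LHS](expectation_cst P) unlock.
rewrite -ge0_integralD//; last 3 first.
- by move=> w _; rewrite lee_fin mulr_ge0.
- by move=> w _; rewrite mule_ge0// sume_ge0// => k _; rewrite lee_fin.
- by apply: measurable_funeM.
(* The right-hand side is now a single integral. On the left, superadditivity brings the sum of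
   squared errors under the integral, which leaves a pointwise inequality. *)
under eq_bigr do rewrite unlock.
apply: (le_trans (ge0_integral_super_sum P _ _ _)).
  by move=> k w; rewrite lee_fin sqr_ge0.
apply: ge0_le_integralT => w.
  by apply: sume_ge0 => k _; rewrite lee_fin sqr_ge0.
rewrite !sumEFin -EFinM -EFinD lee_fin.
pose zeta k := n%:R `^ (- (r / 2)) * z j l k w.
apply: (le_trans (@block_oracle _ _ (Ublock K) (theta j l) zeta t _ t0 _)).
  by move=> k kK; rewrite (block_est_Ublock _ _ _ jj kK).
rewrite mulrDr -/m lerD2l -[leRHS]mulrA ler_pM2l//.
have -> : \sum_(k in Ublock K) zeta k ^+ 2 =
    n%:R `^ (- r) * \sum_(k in Ublock K) z j l k w ^+ 2.
  by rewrite mulr_sumr; apply: eq_bigr => k _; rewrite /zeta exprMn noise_varE.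
rewrite /tail -mulr_suml /bad indicE.
have -> : (t / 4 < n%:R `^ (- r) * \sum_(k in Ublock K) z j l k w ^+ 2) =
    (w \in [set w' | \sum_(k' in Ublock K) (z j l k' w') ^+ 2 >
             lambda * 2 `^ (delta * j%:R) * (blen d r n)%:R ^+ d / 4]).
  rewrite (_ : t / 4 = n%:R `^ (- r) *
      (lambda * 2 `^ (delta * j%:R) * (blen d r n)%:R ^+ d / 4)); last by rewrite /t; ring.
  by rewrite ltr_pM2l//; apply/idP/idP; rewrite inE.
by case: ifP => _; rewrite ?mulr1 ?mulr0.
Qed.

End scale_risk.

(** * Comparison of l^p norms with the l^2 norm *)

Section lp_norms.
Context {R : realType} {I : finType} (x : I -> R).

Lemma lp_norm_ge0 (p : \bar R) : 0 <= lp_norm p x.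
Proof.
by case: p => [p| |]; [exact: powR_ge0|rewrite /lp_norm; exact: bigmax_ge_id|].
Qed.

Lemma lp_norm_powR (p : R) : 0 < p ->
  lp_norm p%:E x `^ p = \sum_i `|x i| `^ p.
Proof.
move=> p0; rewrite /= -powRrM mulVf ?gt_eqF// powRr1//.
by apply: sumr_ge0 => i _; exact: powR_ge0.
Qed.

(* Up to the factor 2, this is Hoelder's inequality on a set of at most [N]
   points; it follows from [u ^ 2 <= 1 + u `^ p]. *)
Lemma sum_sqr_le_lp_norm (p : \bar R) (N : R) :
  (2%:E <= p)%E -> 0 < N -> #|I|%:R <= N ->
  \sum_i x i ^+ 2 <= 2 * N * (N `^ (- inv_exponent p) * lp_norm p x) ^+ 2.
Proof.
case: p => [p| |] // p2 N0 IN; last first.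
  rewrite /lp_norm /inv_exponent oppr0 powRr0 mul1r; set m := \big[Num.max/_]_i _.
  have m0 : 0 <= m by exact: bigmax_ge_id.
  apply: (@le_trans _ _ (\sum_(i : I) m ^+ 2)).
    apply: ler_sum => i _; rewrite -(real_normK (num_real (x i))).
    by rewrite lerXn2r ?nnegrE// /m; exact: le_bigmax_cond.
  by rewrite sumr_const -[leLHS]mulr_natl ler_wpM2r ?sqr_ge0//; lra.
rewrite lee_fin in p2.
have p0 : 0 < p by lra.
set c := _ * lp_norm _ _; set S := \sum_i `|x i| `^ p.
have S0 : 0 <= S by apply: sumr_ge0 => i _; exact: powR_ge0.
have [Sz|SN] := eqVneq S 0.
  rewrite big1 => [|i _]; first by apply: mulr_ge0 (sqr_ge0 _); lra.
  have : `|x i| `^ p == 0.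
    rewrite eq_le powR_ge0 andbT -[X in _ <= X]Sz /S (bigD1 i)//= lerDl.
    by apply: sumr_ge0 => k _; exact: powR_ge0.
  by rewrite powR_eq0 normr_eq0 => /andP[/eqP -> _]; rewrite expr0n.
have Sgt0 : 0 < S by rewrite lt_neqAle eq_sym SN.
have c0 : 0 < c by rewrite mulr_gt0 ?powR_gt0//= powR_gt0.
have cp : c `^ p = S / N.
  rewrite powRM ?powR_ge0 ?lp_norm_ge0// lp_norm_powR// -/S -powRrM /=.
  rewrite mulNr mulVf ?gt_eqF// powR_inv1 ?ltW// mulrC//.
(* Rescaled by [c]: entries at most [c] contribute at most [c ^ 2], and larger ones at most
   [c ^ 2 * (u / c) ^ p] because [p >= 2]. As [c ^ p = S / N], the two parts are each at most
   [N * c ^ 2]. *)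
apply: (@le_trans _ _ (\sum_i (c ^+ 2 + c ^+ 2 / c `^ p * `|x i| `^ p))).
  apply: ler_sum => i _; rewrite -(real_normK (num_real (x i))).
  have [ci|ci] := leP `|x i| c.
    apply: ler_wpDr; first by rewrite mulr_ge0 ?divr_ge0 ?sqr_ge0 ?powR_ge0.
    by rewrite lerXn2r ?nnegrE ?normr_ge0// ltW.
  apply: ler_wpDl; first exact: sqr_ge0.
  rewrite mulrAC ler_pdivlMr ?powR_gt0//.
  have xi0 : 0 < `|x i| by exact: lt_trans ci.
  have e u : 0 < u -> u `^ p = u ^+ 2 * u `^ (p - 2).
    move=> u0; rewrite -(powR_mulrn _ (ltW u0)) -gt0_powRD//.
    by congr (_ `^ _); lra.
  rewrite (e c)// (e `|x i|)// [leLHS]mulrCA ler_wpM2l ?sqr_ge0//.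
  rewrite ler_wpM2l ?sqr_ge0// ge0_ler_powR ?nnegrE ?(ltW c0)//.
  - by lra.
  - exact: ltW.
rewrite big_split /= sumr_const -(mulr_natl (c ^+ 2)) -[X in _ + X]mulr_sumr -/S cp.
rewrite (_ : _ / (S / N) * S = c ^+ 2 * N); last by field; rewrite SN gt_eqF.
by have := sqr_ge0 c; nra.
Qed.

Lemma sum_sqr_le_lp_norm_lt2 (p : R) : 0 < p -> p <= 2 ->
  \sum_i x i ^+ 2 <= lp_norm p%:E x ^+ 2.
Proof.
move=> p0 p2; rewrite -(powR_mulrn _ (lp_norm_ge0 _)).
under eq_bigr do rewrite -(real_normK (num_real _)) -powR_mulrn//.
apply: (sum_powR_le p0 p2 (lp_norm_ge0 _)) => [i|]; first exact: normr_ge0.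
by rewrite lp_norm_powR.
Qed.

End lp_norms.

(** * Consequences of the smoothness norm on one scale *)

Section smoothness.
Context {R : realType} {d : nat} {cs ups : R} {mu : 'I_d -> R}.
Context (s : R) (theta : array cs ups mu R).
Arguments theta : clear implicits.

(** The local [a j l] of [smooth_norm]. *)
Definition smooth_level (p : \bar R) j (l : 'I_(Bcard cs ups j)) : R :=
  2 `^ (j%:R * (s + dstar mu / 2 - dstar mu * inv_exponent p))
    * lp_norm p (theta j l).
Arguments smooth_level p j l : clear implicits.

Lemma smooth_level_ge0 p j l : 0 <= smooth_level p j l.
Proof. by rewrite mulr_ge0 ?powR_ge0 ?lp_norm_ge0. Qed.

Lemma Bcard_le j : 0 <= cs -> (Bcard cs ups j)%:R <= cs * 2 `^ (ups * j%:R).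
Proof. by move=> cs0; rewrite truncn_le mulr_ge0// powR_ge0. Qed.

Lemma smooth_norm_level (p : \bar R) (q M : R) j : 0 < q -> 0 < M ->
  (smooth_norm s p q%:E theta <= M%:E)%E ->
  \sum_l smooth_level p j l `^ q <= M `^ q.
Proof.
move=> q0 M0; rewrite /smooth_norm; set S := (\sum_(0 <= j <oo) _)%E => SM.
have u0 i : (0 <= \sum_(l < Bcard cs ups i) (smooth_level p i l `^ q)%:E)%E.
  by apply: sume_ge0 => l _; rewrite lee_fin powR_ge0.
have S0 : (0 <= S)%E by apply: nneseries_ge0 => i _ _; exact: u0.
have {}SM : (S <= (M `^ q)%:E)%E.
  rewrite -poweR_EFin -(poweRe1 S0) -(mulVf (lt0r_neq0 q0)) poweRrM.
  by rewrite gt0_ler_poweR ?(ltW q0) ?in_itv/= ?leey ?andbT ?poweR_ge0 ?lee_fin ?(ltW M0).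
rewrite -lee_fin -sumEFin; apply: le_trans SM.
apply: (@le_trans _ _ (\sum_(0 <= i < j.+1)
    \sum_(l < Bcard cs ups i) (smooth_level p i l `^ q)%:E)%E).
  by rewrite big_nat_recr//= leeDr//; apply: sume_ge0 => i _; exact: u0.
by apply: nneseries_lim_ge => i _ _; exact: u0.
Qed.

(** The two alternatives of the theorem meet here. If [q <= m], the l^q bound over the levels yields
    an l^m bound with constant [1 <= cs]. If [ups = 0], there are at most [cs] levels, each at most
    [M]. It is used with [m = 2] and [m = p]. *)
Lemma smooth_level_sum (p q : \bar R) (m M : R) j : 1 <= cs -> (0 < q)%E ->
  0 < m -> 0 < M -> ups = 0 \/ (q <= m%:E)%E ->
  (smooth_norm s p q theta <= M%:E)%E ->
  \sum_l smooth_level p j l `^ m <= cs * M `^ m.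
Proof.
move=> cs1 q0 m0 M0 uq thetaM; have Mm0 : 0 <= M `^ m by exact: powR_ge0.
have flat : ups = 0 -> (forall l, smooth_level p j l <= M) ->
    \sum_l smooth_level p j l `^ m <= cs * M `^ m.
  move=> ups0 lM; apply: (@le_trans _ _ (\sum_(l < Bcard cs ups j) M `^ m)).
    apply: ler_sum => l _; rewrite ge0_ler_powR ?nnegrE ?(ltW m0) ?(ltW M0)//.
    exact: smooth_level_ge0.
  rewrite sumr_const card_ord -[leLHS]mulr_natl ler_wpM2r//.
  apply: le_trans (Bcard_le j _) _; first by lra.
  by rewrite ups0 mul0r powRr0 mulr1.
(* For [q = +oo] only the alternative [ups = 0] is possible. *)
case: q q0 uq thetaM => [q| |] // q0 uq thetaM; last first.
  case: uq => // ups0; apply: flat => // l; rewrite -lee_fin.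
  by apply: le_trans thetaM; apply: ereal_sup_ubound; exists j, l.
rewrite lte_fin in q0.
have hq := smooth_norm_level j q0 M0 thetaM.
case: uq => [ups0|]; last first.
  rewrite lee_fin => qm.
  apply: (@le_trans _ _ (M `^ m)); last by rewrite ler_peMl.
  apply: (sum_powR_le q0 qm (ltW M0)) => // l; exact: smooth_level_ge0.
apply: flat => // l; rewrite leNgt; apply/negP => Ml.
have : M `^ q < smooth_level p j l `^ q.
  by rewrite gt0_ltr_powR ?nnegrE ?(ltW M0) ?smooth_level_ge0.
apply/negP; rewrite -leNgt; apply: le_trans hq.
rewrite (bigD1 l)//= lerDl; apply: sumr_ge0 => *; exact: powR_ge0.
Qed.

(** With [N = 2 ^ (d_* j)] in the Hoelder bound, the cardinality factors cancel the part
    [d_* / 2 - d_* / p] of the smoothness weight and leave [2 ^ (- 2 s j)]. *)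
Lemma level_sqr_ge2 (p : \bar R) j l : (2%:E <= p)%E ->
  \sum_k theta j l k ^+ 2 <= 2 * 2 `^ (- (2 * s * j%:R)) * smooth_level p j l `^ 2.
Proof.
move=> p2; have N0 : 0 < 2 `^ (dstar mu * j%:R) :> R by rewrite powR_gt0.
apply: (le_trans (sum_sqr_le_lp_norm (theta j l) p2 N0 (card_Didx_le mu j))).
rewrite powR_mulrn ?smooth_level_ge0// /smooth_level !exprMn.
rewrite [leLHS](_ : _ = 2 * (2 `^ (dstar mu * j%:R) *
  (2 `^ (dstar mu * j%:R) `^ (- inv_exponent p)) ^+ 2) * lp_norm p (theta j l) ^+ 2);
  last by ring.
have -> : 2 `^ (dstar mu * j%:R) * (2 `^ (dstar mu * j%:R) `^ (- inv_exponent p)) ^+ 2 =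
    2 `^ (- (2 * s * j%:R)) *
    2 `^ (j%:R * (s + dstar mu / 2 - dstar mu * inv_exponent p)) ^+ 2 :> R.
  by rewrite !powR_sqr -!powRrM -!gt0_powRD//; congr (_ `^ _); field.
by rewrite !mulrA.
Qed.

Lemma lp_norm_level (p : \bar R) j l : lp_norm p (theta j l) =
  2 `^ (- (j%:R * (s + dstar mu / 2 - dstar mu * inv_exponent p)))
    * smooth_level p j l.
Proof. by rewrite /smooth_level mulrA -gt0_powRD// addNr powRr0 mul1r. Qed.

Lemma level_sqr_lt2 (p : R) j l : 0 < p -> p <= 2 ->
  \sum_k theta j l k ^+ 2 <=
  2 `^ (- (2 * (s + dstar mu / 2 - dstar mu / p) * j%:R))
    * smooth_level p%:E j l `^ 2.
Proof.
move=> p0 p2; apply: (le_trans (sum_sqr_le_lp_norm_lt2 _ p0 p2)).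
rewrite lp_norm_level exprMn powR_sqr powR_mulrn ?smooth_level_ge0//.
rewrite ler_wpM2r ?sqr_ge0//.
by apply: le_powR2; rewrite le_eqVlt; apply/orP; left; apply/eqP; rewrite /=; field; rewrite gt_eqF.
Qed.

(** In each block, [min Th t <= t ^ (1 - p / 2) * Th ^ (p / 2)], and [Th ^ (p / 2)] is at most the
    sum of the [|theta| ^ p] by the embedding of l^p in l^2. These sums add up over disjoint blocks
    to at most the full l^p sum. *)
Lemma level_block_lt2 (p t r : R) n j l : 0 < p -> p <= 2 -> 0 < t ->
  \sum_(K : Aidx mu r n j) Num.min (\sum_(k in Ublock K) theta j l k ^+ 2) t <=
  t `^ (1 - p / 2) *
    2 `^ (- (p * (s + dstar mu / 2 - dstar mu / p) * j%:R))
    * smooth_level p%:E j l `^ p.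
Proof.
move=> p0 p2 t0.
have p21 : 0 < p / 2 <= 1 by apply/andP; split; lra.
apply: (@le_trans _ _ (\sum_(K : Aidx mu r n j) t `^ (1 - p / 2) *
    \sum_(k in Ublock K) `|theta j l k| `^ p)).
  apply: ler_sum => K _; apply: (le_trans (min_le_powR _ t0 p21)).
    by apply: sumr_ge0 => *; exact: sqr_ge0.
  rewrite ler_wpM2l ?powR_ge0//; set S := \sum_(k in _) `|_| `^ _.
  have S0 : 0 <= S by apply: sumr_ge0 => *; exact: powR_ge0.
  rewrite [leRHS](_ : _ = ((S `^ p^-1) `^ 2) `^ (p / 2)); last first.
    by rewrite -!powRrM (_ : _ * _ = 1) ?powRr1//; field; rewrite gt_eqF.
  rewrite ge0_ler_powR ?nnegrE ?powR_ge0//.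
  - by lra.
  - by apply: sumr_ge0 => *; exact: sqr_ge0.
  under eq_bigr do rewrite -(real_normK (num_real _)) -powR_mulrn//.
  apply: (sum_powR_le p0 p2 (powR_ge0 _ _)) => [i|]; first exact: normr_ge0.
  by rewrite -powRrM mulVf ?gt_eqF// powRr1.
rewrite -mulr_sumr -mulrA ler_wpM2l ?powR_ge0//.
apply: (le_trans (@sum_Ublock_le _ _ _ r n j (fun k => `|theta j l k| `^ p) _)).
  by move=> k; exact: powR_ge0.
rewrite -lp_norm_powR// lp_norm_level powRM ?powR_ge0 ?smooth_level_ge0//.
rewrite -powRrM ler_wpM2r ?powR_ge0//.
by apply: le_powR2; rewrite le_eqVlt; apply/orP; left; apply/eqP; rewrite /=; ring.
Qed.

End smoothness.

(** * Bounds for the risk of a single scale *)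

Section risk_bound.
Context {dT : measure_display} {T : measurableType dT} {R : realType}
  {P : probability T R} {d : nat} {cs ups : R} {mu : 'I_d -> R}.
Context (r delta lambda : R) (n : nat) (z : noise_array P cs ups mu)
  (theta : array cs ups mu R).
Arguments z : clear implicits.
Arguments theta : clear implicits.
Hypotheses (n0 : (0 < n)%N) (lambda0 : 0 < lambda) (cs1 : 1 <= cs)
  (L0 : (0 < blen d r n)%N).

Let G : R := dstar mu + delta + ups.

Definition block_threshold j : R :=
  lambda * n%:R `^ (- r) * 2 `^ (delta * j%:R) * (blen d r n)%:R ^+ d.

Definition block_min j (l : 'I_(Bcard cs ups j)) : R :=
  \sum_(K : Aidx mu r n j)
    Num.min (\sum_(k in Ublock K) theta j l k ^+ 2) (block_threshold j).
Arguments block_min j l : clear implicits.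

(** The deterministic part of the risk from [jlow] on: the oracle terms while blocks are kept, then
    the whole discarded signal. *)
Definition level_bias j (l : 'I_(Bcard cs ups j)) : R :=
  if (j <= jhigh mu ups delta r n)%N then block_min j l
  else \sum_k theta j l k ^+ 2.
Arguments level_bias j l : clear implicits.

Definition level_risk j : \bar R := (\sum_(l < Bcard cs ups j)
  scale_sum ups delta r n (fun k : Didx mu j =>
    'E_P[fun w => ((block_est r delta lambda n
           (observation r n theta (fun j l k => z j l k w)) j l k
         - theta j l k) ^+ 2)%R]))%E.

Definition level_tail j : \bar R := (\sum_(l < Bcard cs ups j)
   \sum_(K : Aidx mu r n j) \sum_(k in Ublock K)
     'E_P[fun w => ((z j l k w) ^+ 2 *
        \1_[set w' | \sum_(k' in Ublock K) (z j l k' w') ^+ 2 >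
             lambda * 2 `^ (delta * j%:R) * (blen d r n)%:R ^+ d / 4] w)%R])%E.

Lemma block_threshold_gt0 j : 0 < block_threshold j.
Proof. by rewrite !mulr_gt0 ?powR_gt0 ?exprn_gt0 ?ltr0n. Qed.

Lemma block_min_ge0 j l : 0 <= block_min j l.
Proof.
apply: sumr_ge0 => K _; rewrite le_min (ltW (block_threshold_gt0 _)) andbT.
by apply: sumr_ge0 => k _; exact: sqr_ge0.
Qed.

Lemma block_min_le_sqr j l : block_min j l <= \sum_k theta j l k ^+ 2.
Proof.
apply: (@le_trans _ _
    (\sum_(K : Aidx mu r n j) \sum_(k in Ublock K) theta j l k ^+ 2)).
  by apply: ler_sum => K _; rewrite ge_min lexx.
by apply: (@sum_Ublock_le _ _ _ r n j (fun k => theta j l k ^+ 2)) => k; exact: sqr_ge0.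
Qed.

(** Bound every minimum by the threshold and count the blocks. *)
Lemma block_min_le j l : block_min j l <=
  lambda * n%:R `^ (- r) * 2 `^ ((dstar mu + delta) * j%:R).
Proof.
apply: (@le_trans _ _ (\sum_(K : Aidx mu r n j) block_threshold j)).
  by apply: ler_sum => K _; rewrite ge_min lexx orbT.
rewrite sumr_const -[leLHS]mulr_natl /block_threshold mulrCA mulrDl gt0_powRD//.
rewrite [X in _ <= _ * X]mulrC [leRHS]mulrA ler_wpM2l ?card_Aidx_le//.
by rewrite !mulr_ge0 ?powR_ge0// ltW.
Qed.

Lemma level_bias_ge0 j l : 0 <= level_bias j l.
Proof.
rewrite /level_bias; case: ifP => _; first exact: block_min_ge0.
by apply: sumr_ge0 => k _; exact: sqr_ge0.
Qed.

Lemma level_bias_le_sqr j l : level_bias j l <= \sum_k theta j l k ^+ 2.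
Proof. by rewrite /level_bias; case: ifP => _ //; exact: block_min_le_sqr. Qed.

Lemma sum_level_le j (c e : R) : 0 <= c ->
  (\sum_(l < Bcard cs ups j) c * 2 `^ (e * j%:R))
    <= cs * c * 2 `^ ((e + ups) * j%:R).
Proof.
move=> c0; rewrite sumr_const card_ord -[leLHS]mulr_natl mulrDl gt0_powRD//.
apply: (@le_trans _ _ (cs * 2 `^ (ups * j%:R) * (c * 2 `^ (e * j%:R)))).
  rewrite ler_wpM2r ?mulr_ge0 ?powR_ge0// Bcard_le//; exact: le_trans ler01 cs1.
by rewrite le_eqVlt; apply/orP; left; apply/eqP; ring.
Qed.

Lemma level_risk_ge0 j : (0 <= level_risk j)%E.
Proof.
apply: sume_ge0 => l _; rewrite /scale_sum /block_sum.
case: ifP => _; last by apply: sume_ge0 => k _; apply: expectation_ge0 => w; exact: sqr_ge0.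
apply: sume_ge0 => K _; apply: sume_ge0 => k _.
by apply: expectation_ge0 => w; exact: sqr_ge0.
Qed.

Lemma level_tail_ge0 j : (0 <= level_tail j)%E.
Proof.
apply: sume_ge0 => l _; apply: sume_ge0 => K _; apply: sume_ge0 => k _.
by apply: expectation_ge0 => w; rewrite mulr_ge0 ?sqr_ge0.
Qed.

Lemma level_risk_coarse (Q1 : R) j : 0 < Q1 -> assumption_A1 r delta Q1 n z ->
  (j < jlow mu r n)%N -> (j <= Jmax R n)%N ->
  (level_risk j <= (cs * (Q1 * n%:R `^ (- r)) * 2 `^ (G * j%:R))%:E)%E.
Proof.
move=> Q10 A1 jl jJ.
apply: (@le_trans _ _ (\sum_(l < Bcard cs ups j)
    (Q1 * n%:R `^ (- r) * 2 `^ ((dstar mu + delta) * j%:R))%:E)%E); last first.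
  by rewrite sumEFin lee_fin sum_level_le// mulr_ge0 ?powR_ge0 ?ltW.
apply: lee_sum => l _; have := A1 j l jJ.
rewrite /scale_sum leqNgt jl /= risk_coarse//.
set X := (\sum_k _)%E; rewrite [2 `^ (- _)]powRN (mulrC j%:R).
have : 0 < 2 `^ ((dstar mu + delta) * j%:R) :> R by rewrite powR_gt0.
move: (2 `^ _) => c c0 hA1.
have XQ : (X <= (c * Q1)%:E)%E.
  rewrite -[X]mul1e -(mulfV (lt0r_neq0 c0)) EFinM -muleA EFinM.
  by rewrite lee_wpmul2l// lee_fin ltW.
rewrite (_ : Q1 * _ * c = n%:R `^ (- r) * (c * Q1)); last by ring.
by rewrite EFinM lee_wpmul2l// lee_fin powR_ge0.
Qed.

Lemma level_risk_block j : (jlow mu r n <= j <= jhigh mu ups delta r n)%N ->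
  (level_risk j <= (10 * \sum_l block_min j l)%:E
     + (10 * n%:R `^ (- r))%:E * level_tail j)%E.
Proof.
move=> jj; have c0 : 0 <= 10 * n%:R `^ (- r) :> R by rewrite mulr_ge0 ?powR_ge0.
have E0 (l : 'I_(Bcard cs ups j)) (K : Aidx mu r n j) : (0 <= \sum_(k in Ublock K)
     'E_P[fun w => ((z j l k w) ^+ 2 *
        \1_[set w' | \sum_(k' in Ublock K) (z j l k' w') ^+ 2 >
             lambda * 2 `^ (delta * j%:R) * (blen d r n)%:R ^+ d / 4] w)%R])%E.
  apply: sume_ge0 => k _; apply: expectation_ge0 => w.
  by rewrite mulr_ge0 ?sqr_ge0.
rewrite /level_tail ge0_sume_distrr; last first.
  by move=> l _; apply: sume_ge0 => K _; exact: E0.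
rewrite mulr_sumr -sumEFin -big_split /=; apply: lee_sum => l _.
rewrite ge0_sume_distrr => [|K _]; last exact: E0.
rewrite /scale_sum jj /block_sum /block_min mulr_sumr -sumEFin -big_split /=.
by apply: lee_sum => K _; exact: risk_block.
Qed.

Lemma level_risk_fine j :
  (jlow mu r n <= j)%N -> (jhigh mu ups delta r n < j)%N ->
  (level_risk j <= (\sum_l level_bias j l)%:E)%E.
Proof.
move=> jl jh; rewrite -sumEFin; apply: lee_sum => l _.
by rewrite /scale_sum /level_bias [(j <= _)%N]leqNgt jh andbF risk_fine.
Qed.

(** Since [jlow <= x], the unshrunk scales lie below the cut, where their variance has the same
    order as the sum of the thresholds; since [x <= r / G * log2 n], the discarded scales lie above
    it. The bound [jlow <= Jmax] makes (A1) available at the unshrunk scales. *)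
Lemma level_risk_le (Q1 x : R) j : 0 < Q1 -> assumption_A1 r delta Q1 n z ->
  (jlow mu r n <= Jmax R n)%N -> (jlow mu r n)%:R <= x ->
  x <= r / G * log2 n%:R ->
  (level_risk j <=
    ((if j%:R <= x then cs * ((Q1 + 10 * lambda) * n%:R `^ (- r)) * 2 `^ (G * j%:R)
      else 0) +
     (if x < j%:R then 10 * \sum_l level_bias j l else 0))%:E +
    (10 * n%:R `^ (- r))%:E *
      (if (jlow mu r n <= j <= jhigh mu ups delta r n)%N then level_tail j else 0))%E.
Proof.
move=> Q10 A1 jJ jx xw.
have nr0 : 0 <= n%:R `^ (- r) :> R by exact: powR_ge0.
have c0 : (0 <= (10 * n%:R `^ (- r))%:E :> \bar R)%E by rewrite lee_fin mulr_ge0.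
(* Nonnegativity lets [truncn] act as the floor, so that [jhigh < j] gives [r / G * log2 n < j]. *)
have w0 : 0 <= r / G * log2 n%:R by apply: le_trans xw; apply: le_trans jx; exact: ler0n.
have [jl|jl] := ltnP j (jlow mu r n).
  rewrite /= mule0 adde0.
  have jx' : j%:R <= x by apply: le_trans jx; rewrite ler_nat ltnW.
  rewrite jx' ltNge jx' addr0.
  apply: (le_trans (level_risk_coarse Q10 A1 jl _)); first exact: leq_trans (ltnW jl) jJ.
  rewrite lee_fin ler_wpM2r ?powR_ge0// ler_wpM2l ?(le_trans ler01 cs1)//.
  by rewrite ler_wpM2r//; move: lambda0; lra.
have [jh|jh] := leqP j (jhigh mu ups delta r n).
  apply: (le_trans (level_risk_block _)); first by rewrite jl.
  rewrite leeD2r// lee_fin; have [jx'|jx'] := leP j%:R x.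
    rewrite addr0; apply: (@le_trans _ _ (10 * \sum_(l < Bcard cs ups j)
        (lambda * n%:R `^ (- r)) * 2 `^ ((dstar mu + delta) * j%:R))).
      by rewrite ler_pM2l//; apply: ler_sum => l _; exact: block_min_le.
    apply: (@le_trans _ _ (10 * (cs * (lambda * n%:R `^ (- r)) * 2 `^ (G * j%:R)))).
      by rewrite ler_pM2l// sum_level_le// mulr_ge0// ltW.
    rewrite !mulrA ler_wpM2r ?powR_ge0// ler_wpM2r// mulrAC mulrC.
    by rewrite ler_wpM2l ?(le_trans ler01 cs1)// lerDr ltW.
  rewrite add0r ler_pM2l//; apply: ler_sum => l _.
  by rewrite /level_bias jh.
rewrite mule0 adde0; have jx' : x < j%:R.
  apply: le_lt_trans xw _; rewrite -truncn_lt_nat//.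
rewrite jx' [j%:R <= x]leNgt jx' add0r; apply: (le_trans (level_risk_fine jl jh)).
rewrite lee_fin ler_peMl//; last by lra.
by apply: sumr_ge0 => l _; exact: level_bias_ge0.
Qed.

End risk_bound.

(** * Summation over all scales *)

Section total_risk.
Context {dT : measure_display} {T : measurableType dT} {R : realType}
  {P : probability T R} {d : nat} {cs ups : R} {mu : 'I_d -> R}.
Context (r delta lambda : R) (n : nat) (z : noise_array P cs ups mu)
  (theta : array cs ups mu R).

Lemma sum_level_tail_le (Q2 : R) N : assumption_A2 r delta lambda Q2 n z ->
  (\sum_(0 <= j < N)
    (if (jlow mu r n <= j <= jhigh mu ups delta r n)%N
     then level_tail r delta lambda n z j else 0) <= Q2%:E)%E.
Proof.
move=> A2; pose f j := if (jlow mu r n <= j <= jhigh mu ups delta r n)%N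
  then level_tail r delta lambda n z j else 0%E.
have f0 j : (0 <= f j)%E by rewrite /f; case: ifP => // _; exact: level_tail_ge0.
apply: le_trans A2; pose N' := maxn N (jhigh mu ups delta r n).+1.
apply: (@le_trans _ _ (\sum_(0 <= j < N') f j)%E).
  by apply: lee_sum_nneg_natr => [j _ _|]; [exact: f0|exact: leq_maxl].
rewrite [leRHS](big_nat_widenl _ 0%N)//.
rewrite [leRHS](@big_nat_widen _ _ _ _ _ N') ?leq_maxr// [leRHS]big_mkcond.
by apply: lee_sum => j _; rewrite /f ltnS.
Qed.

(** The pair [F], [eta] describes the decay of the bias beyond the cut [x]; the pair [F'], [eta']
    adds a possibly different decay beyond [w], past the last block scale. Each geometric series is
    then of the order of its value at the start of its range. *)
Lemma risk_le (Q1 Q2 x eta eta' F F' : R)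
    (G := dstar mu + delta + ups) (w := r / G * log2 n%:R) :
  (0 < n)%N -> 0 < lambda -> 1 <= cs -> (0 < blen d r n)%N -> 0 < G ->
  0 < Q1 -> assumption_A1 r delta Q1 n z -> assumption_A2 r delta lambda Q2 n z ->
  (jlow mu r n <= Jmax R n)%N -> (jlow mu r n)%:R <= x -> x <= w ->
  0 < eta -> 0 < eta' -> 0 <= F -> 0 <= F' ->
  (forall j, x < j%:R -> \sum_l level_bias r delta lambda n theta (j := j) l <=
     F * 2 `^ (- (eta * j%:R)) +
     (if w < j%:R then F' * 2 `^ (- (eta' * j%:R)) else 0)) ->
  (risk r delta lambda n z theta <=
   (cs * (Q1 + 10 * lambda) * (2 `^ G / (2 `^ G - 1)) * (n%:R `^ (- r) * 2 `^ (G * x))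
    + 10 * (1 - 2 `^ (- eta))^-1 * (F * 2 `^ (- (eta * x)))
    + 10 * (1 - 2 `^ (- eta'))^-1 * (F' * 2 `^ (- (eta' * w)))
    + 10 * Q2 * n%:R `^ (- r))%:E)%E.
Proof.
move=> n0 lambda0 cs1 L0 G0 Q10 A1 A2 jJ jx xw eta0 eta'0 F0 F'0 bias.
have nr0 : 0 <= n%:R `^ (- r) :> R by exact: powR_ge0.
have c0 : (0 <= (10 * n%:R `^ (- r))%:E :> \bar R)%E by rewrite lee_fin mulr_ge0.
pose noise j := if (jlow mu r n <= j <= jhigh mu ups delta r n)%N
  then level_tail r delta lambda n z j else 0%E.
have noise0 j : (0 <= noise j)%E.
  by rewrite /noise; case: ifP => // _; exact: level_tail_ge0.
pose g1 j : R := if j%:R <= x then 2 `^ (G * j%:R) else 0.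
pose g2 j : R := if x < j%:R then 2 `^ (- (eta * j%:R)) else 0.
pose g3 j : R := if w < j%:R then 2 `^ (- (eta' * j%:R)) else 0.
pose A : R := cs * ((Q1 + 10 * lambda) * n%:R `^ (- r)).
have A0 : 0 <= A.
  apply: mulr_ge0; first exact: le_trans ler01 cs1.
  by apply: mulr_ge0 => //; lra.
apply: lime_le; first by apply: is_cvg_nneseries => j _ _; exact: level_risk_ge0.
(* All partial sums obey the same bound, hence so does their limit. *)
apply: nearW => N.
apply: (@le_trans _ _ (\sum_(0 <= j < N) ((A * g1 j + 10 * F * g2 j
    + 10 * F' * g3 j)%:E + (10 * n%:R `^ (- r))%:E * noise j))%E).
  apply: lee_sum => j _.
  rewrite -/(level_risk r delta lambda n z theta j).
  apply: (le_trans (level_risk_le theta n0 lambda0 cs1 L0 j Q10 A1 jJ jx xw)).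
  rewrite -/(noise j) leeD2r// lee_fin -[leRHS]addrA; apply: lerD.
    by rewrite /g1; case: ifP => _; rewrite ?mulr0.
  rewrite /g2; have [xj|xj] := ltP x j%:R; last first.
    by rewrite mulr0 add0r mulr_ge0 ?mulr_ge0// /g3; case: ifP.
  rewrite -!mulrA -mulrDr ler_pM2l//; apply: le_trans (bias _ xj) _.
  by rewrite lerD2l /g3; case: ifP => _; rewrite ?mulr0.
rewrite big_split /= -ge0_sume_distrr => [|j _]; last exact: noise0.
rewrite sumEFin EFinD; apply: leeD; last first.
  rewrite (_ : 10 * Q2 * n%:R `^ (- r) = 10 * n%:R `^ (- r) * Q2); last by ring.
  by rewrite [leRHS]EFinM lee_wpmul2l// sum_level_tail_le.
rewrite lee_fin !big_split /= -!mulr_sumr; apply: lerD; first apply: lerD.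
- rewrite [leRHS](_ : _ = A * (2 `^ G / (2 `^ G - 1) * 2 `^ (G * x))).
    by rewrite ler_wpM2l// geometric_below.
  by rewrite /A; ring.
- rewrite [leRHS](_ : _ = 10 * F * ((1 - 2 `^ (- eta))^-1 * 2 `^ (- (eta * x)))).
    by rewrite ler_wpM2l ?mulr_ge0// geometric_above.
  by ring.
- rewrite [leRHS](_ : _ = 10 * F' * ((1 - 2 `^ (- eta'))^-1 * 2 `^ (- (eta' * w)))).
    by rewrite ler_wpM2l ?mulr_ge0// geometric_above.
  by ring.
Qed.

End total_risk.

(** * Size of the block length and of the coarsest block scale *)

Section scales.
Context {R : realType} {d : nat} (mu : 'I_d -> R) (r : R).
Hypotheses (d0 : (0 < d)%N) (r1 : 1 <= r) (mu0 : forall i, 0 < mu i).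

Lemma inf_range_gt0 : 0 < inf (range mu).
Proof.
pose i0 := [arg min_(i < Ordinal d0) mu i]%O.
have muE i : mu i0 <= mu i by rewrite /i0; case: arg_minP => // k _; exact.
apply: (lt_le_trans (mu0 i0)); apply: lb_le_inf; first by exists (mu i0), i0.
by move=> _ [i _ <-].
Qed.

Lemma dstar_gt0 : 0 < dstar mu.
Proof.
rewrite /dstar (bigD1 (Ordinal d0))//=; apply: ltr_pwDl => //.
by apply: sumr_ge0 => i _; exact: ltW.
Qed.

Lemma near_ln_ge1 : \forall n \near \oo, 1 <= ln (n%:R : R).
Proof.
near=> n; have en : expR 1 < n%:R :> R by near: n; exact: nbhs_infty_gtr.
by rewrite -[leLHS]expRK ler_ln ?posrE ?expR_gt0 ?(lt_trans (expR_gt0 1))// ltW.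
Unshelve. all: by end_near. Qed.

Lemma ln_ge1_nat_gt0 (n : nat) : 1 <= ln (n%:R : R) -> (0 < n)%N.
Proof. by case: n => // ; rewrite ln0// ler10. Qed.

Lemma blen_gt0 n : 1 <= ln (n%:R : R) -> (0 < blen d r n)%N.
Proof.
move=> ln1; have rln : 1 <= r * ln (n%:R : R) by move: r1; nra.
have one_powR : 1 `^ d%:R^-1 = 1 :> R by rewrite powR1.
by rewrite truncn_gt0 -[leLHS]one_powR ge0_ler_powR ?nnegrE ?invr_ge0 ?(le_trans ler01 rln).
Qed.

Lemma blen_exp_le n : 1 <= ln (n%:R : R) ->
  (blen d r n)%:R ^+ d <= r * ln (n%:R : R).
Proof.
move=> ln1; have rln : 0 <= r * ln (n%:R : R) by move: r1; nra.
have dR : d%:R != 0 :> R by rewrite pnatr_eq0 -lt0n.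
rewrite -[leRHS](powRr1 rln) -[X in _ `^ X](mulVf dR) powRrM powR_mulrn ?powR_ge0//.
rewrite lerXn2r ?nnegrE ?ler0n ?powR_ge0//.
by rewrite /blen truncn_le powR_ge0.
Qed.

Lemma ln2_gt0 : 0 < ln 2 :> R.
Proof. by rewrite ln_gt0// ltr1n. Qed.

(** [jlow] grows like [log log n], since [L ^ d <= r ln n], whereas the right-hand side grows like
    [log n]. *)
Lemma near_jlow_le (c : R) : 0 < c ->
  \forall n \near \oo, (jlow mu r n)%:R <= c * log2 (n%:R / ln n%:R : R).
Proof.
move=> c0; have dR : 0 < d%:R :> R by rewrite ltr0n.
have i0 := inf_range_gt0; have l2 := ln2_gt0.
pose a := (inf (range mu))^-1 * d%:R^-1.
have a0 : 0 < a by rewrite mulr_gt0 ?invr_gt0.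
near=> n.
have ln1 : 1 <= ln (n%:R : R) by near: n; exact: near_ln_ge1.
have n0 : 0 < n%:R :> R by rewrite ltr0n ln_ge1_nat_gt0.
(* [h1] gives [ln (ln n) <= ln n / 2], so the right-hand side is at least [(c / 2) * log2 n]. The
   exponent in [h2] is chosen so that [a * ln (r ln n)], which dominates [jlow * ln 2], is at most
   [(c / 2) * ln n]. *)
have h1 : 1 * ln (n%:R : R) <= n%:R `^ (1 / 2).
  by near: n; apply: near_ln_le_powR => //; lra.
have h2 : r * ln (n%:R : R) <= n%:R `^ (c / (2 * a)).
  by near: n; apply: near_ln_le_powR; [exact: lt_le_trans r1|rewrite divr_gt0// mulr_gt0].
have L1 : 1 <= (blen d r n)%:R :> R by rewrite ler1n blen_gt0.
have rln0 : 0 < r * ln (n%:R : R) by move: r1; nra.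
have lnn0 : 0 < ln (n%:R : R) by lra.
apply: (@le_trans _ _ (1 / inf (range mu) * log2 (blen d r n)%:R)).
  by rewrite /jlow truncn_le /log2 mulr_ge0 ?divr_ge0 ?(ltW i0) ?(ltW l2) ?ln_ge0.
rewrite /log2 mulrA mulrA ler_pM2r ?invr_gt0// div1r.
apply: (@le_trans _ _ (a * ln (r * ln n%:R))).
  rewrite /a -mulrA ler_pM2l ?invr_gt0// -[leRHS]ln_powR ler_ln ?posrE ?powR_gt0//.
    by rewrite /blen truncn_le powR_ge0.
  by lra.
apply: (@le_trans _ _ (c / 2 * ln n%:R)).
  rewrite [leRHS](_ : _ = a * (c / (2 * a) * ln n%:R)); last first.
    by field; rewrite gt_eqF.
  by rewrite ler_pM2l// -[leRHS]ln_powR ler_ln ?posrE ?powR_gt0.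
rewrite -mulrA ler_pM2l// ln_div ?posrE//.
have : ln (ln (n%:R : R)) <= 1 / 2 * ln n%:R.
  by rewrite -[leRHS]ln_powR ler_ln ?posrE ?powR_gt0//; lra.
by lra.
Unshelve. all: by end_near. Qed.

End scales.

(** * Choice of the cut and the resulting rates *)

Section rates.
Context {R : realType} {d : nat} (r cs ups : R) (mu : 'I_d -> R).
Context (dT : nat -> measure_display) (T : forall n, measurableType (dT n))
  (P : forall n, probability (T n) R) (z : forall n, noise_array (P n) cs ups mu).
Context (delta lambda Q1 Q2 s M : R) (q : \bar R).
Hypotheses (d0 : (0 < d)%N) (r1 : 1 <= r) (cs1 : 1 <= cs) (ups0 : 0 <= ups)
  (mu0 : forall i, 0 < mu i) (delta0 : 0 <= delta) (lambda0 : 0 < lambda)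
  (Q10 : 0 < Q1) (Q20 : 0 < Q2)
  (A1 : \forall n \near \oo, assumption_A1 r delta Q1 n (z n))
  (A2 : \forall n \near \oo, assumption_A2 r delta lambda Q2 n (z n))
  (s0 : 0 < s) (q0 : (0 < q)%E) (M0 : 0 < M).

Let G : R := dstar mu + delta + ups.
Let D : R := 2 * s + delta + dstar mu + ups.

Lemma rate_denominators : [/\ 0 < G, 0 < D & D = 2 * s + G].
Proof.
have dst0 := dstar_gt0 d0 mu0.
by move: delta0 ups0 s0; rewrite /G /D; split; lra.
Qed.

(** The balance defining the cut: if [2 ^ x = n ^ (r / D)], then [n ^ (- r) * 2 ^ (G x)] and
    [2 ^ (- 2 s x)] have the same order. *)
Lemma variance_exponent : - r + G * (r / D) = - (2 * s * r / D).
Proof.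
have [_ D0 DG] := rate_denominators.
have -> : G = D - 2 * s by rewrite DG addrC addKr.
by field; rewrite gt_eqF.
Qed.

Lemma near_scales : \forall n \near \oo,
  [/\ 1 <= ln (n%:R : R), assumption_A1 r delta Q1 n (z n),
      assumption_A2 r delta lambda Q2 n (z n),
      (jlow mu r n <= Jmax R n)%N &
      (jlow mu r n)%:R <= r / D * log2 (n%:R / ln n%:R : R)].
Proof.
have [_ D0 _] := rate_denominators.
have rD0 : 0 < r / D by rewrite divr_gt0// (lt_le_trans ltr01).
have l2 := @ln2_gt0 R.
near=> n.
have ln1 : 1 <= ln (n%:R : R) by near: n; exact: near_ln_ge1.
split => //.
- by near: n; exact: A1.
- by near: n; exact: A2.
- have n0 : (0 < n)%N := ln_ge1_nat_gt0 ln1.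
  have nR : 0 < n%:R :> R by rewrite ltr0n.
  have log0 : 0 <= log2 (n%:R : R) by rewrite divr_ge0 ?(ltW l2)//; lra.
  rewrite leqNgt truncn_lt_nat// -leNgt.
  apply: (@le_trans _ _ (1 * log2 (n%:R / ln n%:R : R))).
    by near: n; exact: near_jlow_le.
  rewrite mul1r ler_pM2r ?invr_gt0// ln_div ?posrE//; last by lra.
  by rewrite lerBlDr lerDl ln_ge0.
- by near: n; exact: near_jlow_le.
Unshelve. all: by end_near. Qed.

Lemma rate_ge2 (p : \bar R) : (2%:E <= p)%E -> ups = 0 \/ (q <= 2%:E)%E ->
  bounded_by_rate (fun n => max_risk r delta lambda s p q M n (z n))
    (fun n => n%:R `^ (- (2 * s * r / D))).
Proof.
move=> p2 uq; have [G0 D0 DG] := rate_denominators; have l2 := @ln2_gt0 R.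
have r0 : 0 < r by exact: lt_le_trans r1.
have cs0 : 0 < cs by exact: lt_le_trans cs1.
have s20 : 0 < 2 * s by rewrite mulr_gt0.
pose F := 2 * (cs * M `^ 2).
pose C1 := cs * (Q1 + 10 * lambda) * (2 `^ G / (2 `^ G - 1)).
pose C2 := 10 * (1 - 2 `^ (- (2 * s)))^-1.
have F0 : 0 < F by rewrite !mulr_gt0// powR_gt0.
have C10 : 0 < C1.
  rewrite mulr_gt0 ?divr_gt0 ?powR_gt0 ?subr_gt0 ?gt1_powR2//.
  by rewrite mulr_gt0// addr_gt0// mulr_gt0.
have C20 : 0 < C2.
  by rewrite mulr_gt0// invr_gt0 subr_gt0 powRN invf_lt1 ?powR_gt0// gt1_powR2.
exists (C1 + C2 * F + 10 * Q2); first by rewrite !addr_gt0// mulr_gt0.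
near=> n.
have [ln1 A1n A2n jJ jx] : [/\ 1 <= ln (n%:R : R), assumption_A1 r delta Q1 n (z n),
    assumption_A2 r delta lambda Q2 n (z n), (jlow mu r n <= Jmax R n)%N &
    (jlow mu r n)%:R <= r / D * log2 (n%:R / ln n%:R : R)].
  by near: n; exact: near_scales.
have n0 : (0 < n)%N := ln_ge1_nat_gt0 ln1.
have nR : 0 < n%:R :> R by rewrite ltr0n.
have nR1 : 1 <= n%:R :> R by rewrite ler1n.
have log0 : 0 <= log2 (n%:R : R) by rewrite divr_ge0 ?(ltW l2)//; lra.
apply: ge_ereal_sup => _ [theta thetaM <-].
pose x : R := r / D * log2 n%:R.
have powRx a : 2 `^ (a * x) = n%:R `^ (a * (r / D)).
  by rewrite -(powR_log2 _ nR) -mulrA.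
have jx' : (jlow mu r n)%:R <= x.
  apply: le_trans jx _; rewrite ler_pM2l ?divr_gt0//.
  rewrite ler_pM2r ?invr_gt0// ln_div ?posrE//; last by lra.
  by rewrite lerBlDr lerDl ln_ge0.
have xw : x <= r / G * log2 n%:R.
  by rewrite ler_wpM2r// ler_pM2l// lef_pV2 ?posrE// DG lerDr ltW.
(* For [p >= 2] the full energy decays like [2 ^ (- 2 s j)] on both sides of [jhigh], so the second
   bias term is taken with [F' = 0] and the placeholder exponent 1. *)
have bias j : x < j%:R -> \sum_l level_bias r delta lambda n theta (j := j) l <=
     F * 2 `^ (- (2 * s * j%:R)) +
     (if r / G * log2 n%:R < j%:R then 0 * 2 `^ (- (1 * j%:R)) else 0).
  move=> _; rewrite mul0r if_same addr0.
  apply: (@le_trans _ _ (\sum_l 2 * 2 `^ (- (2 * s * j%:R))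
      * smooth_level s theta p (j := j) l `^ 2)).
    apply: ler_sum => l _; apply: le_trans (level_sqr_ge2 _ _ _ p2).
    exact: level_bias_le_sqr.
  rewrite -mulr_sumr /F mulrAC ler_wpM2r ?powR_ge0// ler_pM2l//.
  exact: (smooth_level_sum _ cs1 q0).
apply: (le_trans (risk_le n0 lambda0 cs1 (blen_gt0 r1 ln1) G0 Q10 A1n A2n jJ jx'
  xw s20 ltr01 (ltW F0) (lexx 0) bias)).
rewrite -/C1 -/C2 mul0r mulr0 addr0 lee_fin.
rewrite [leRHS]mulrDl [X in _ <= X + _]mulrDl.
apply: lerD; first apply: lerD.
- by rewrite ler_pM2l// -/G powRx -gt0_powRD// variance_exponent.
- rewrite mulrA ler_pM2l; last exact: mulr_gt0.
  rewrite -mulNr powRx.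
  rewrite le_eqVlt; apply/orP; left; apply/eqP; congr (_ `^ _).
  by field; rewrite gt_eqF.
- rewrite ler_pM2l ?mulr_gt0// ler_powR// lerN2.
  by rewrite ler_pdivrMr// mulrC ler_pM2l// DG lerDl ltW.
Unshelve. all: by end_near. Qed.

Lemma rate_lt2 (p : R) : 0 < p -> p < 2 ->
  Num.max (dstar mu) ((1 - p / 2) * (delta + dstar mu + ups)) < s * p ->
  ups = 0 \/ (q <= p%:E)%E ->
  bounded_by_rate (fun n => max_risk r delta lambda s p%:E q M n (z n))
    (fun n => (ln n%:R / n%:R) `^ (2 * s * r / D)).
Proof.
move=> p0 p2; rewrite gt_max => /andP[spd spG] uq.
have [G0 D0 DG] := rate_denominators; have l2 := @ln2_gt0 R.
have dst0 := dstar_gt0 d0 mu0.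
have r0 : 0 < r by exact: lt_le_trans r1.
have cs0 : 0 < cs by exact: lt_le_trans cs1.
have uq2 : ups = 0 \/ (q <= 2%:E)%E.
  case: uq => [|qp]; [by left|right].
  by apply: le_trans qp _; rewrite lee_fin ltW.
pose h : R := 1 - p / 2; have h0 : 0 <= h by rewrite /h; lra.
(* [e] is the smoothness left after embedding l^p in l^2; it is positive because [s p > d_*]. *)
pose e : R := s + dstar mu / 2 - dstar mu / p.
have pe : p * e = s * p - dstar mu * h by rewrite /e /h; field; rewrite gt_eqF.
have spG' : h * G < s * p by rewrite (_ : G = delta + dstar mu + ups)// /G; ring.
have e0 : 0 < e.
  rewrite /e; suff : dstar mu / p < s by lra.
  by rewrite ltr_pdivrMr.
(* The interpolated bound [t ^ h * 2 ^ (- p e j)] contains [2 ^ (delta h j)] through [t], so it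
   decays at rate [eta]. Positivity follows from [s p > h * G], since
   [eta = s p - (d_* + delta) * h]. *)
pose eta : R := p * e - delta * h.
have eta0 : 0 < eta.
  rewrite /eta pe; have : 0 <= h * ups by rewrite mulr_ge0.
  by move: spG'; rewrite /G; lra.
have e20 : 0 < 2 * e by rewrite mulr_gt0.
have Mp0 : 0 < M `^ p by rewrite powR_gt0.
pose K := (lambda * r) `^ h * (cs * M `^ p).
have K0 : 0 < K by rewrite !mulr_gt0// powR_gt0// mulr_gt0.
pose F' := cs * M `^ 2.
have F'0 : 0 < F' by rewrite mulr_gt0// powR_gt0.
pose C1 := cs * (Q1 + 10 * lambda) * (2 `^ G / (2 `^ G - 1)).
pose C2 := 10 * (1 - 2 `^ (- eta))^-1.
pose C3 := 10 * (1 - 2 `^ (- (2 * e)))^-1.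
have C10 : 0 < C1.
  rewrite mulr_gt0 ?divr_gt0 ?powR_gt0 ?subr_gt0 ?gt1_powR2//.
  by rewrite mulr_gt0// addr_gt0// mulr_gt0.
have C20 : 0 < C2.
  by rewrite mulr_gt0// invr_gt0 subr_gt0 powRN invf_lt1 ?powR_gt0// gt1_powR2.
have C30 : 0 < C3.
  by rewrite mulr_gt0// invr_gt0 subr_gt0 powRN invf_lt1 ?powR_gt0// gt1_powR2.
exists (C1 + C2 * K + C3 * F' + 10 * Q2).
  by rewrite !addr_gt0// mulr_gt0.
near=> n.
have [ln1 A1n A2n jJ jx] : [/\ 1 <= ln (n%:R : R), assumption_A1 r delta Q1 n (z n),
    assumption_A2 r delta lambda Q2 n (z n), (jlow mu r n <= Jmax R n)%N &
    (jlow mu r n)%:R <= r / D * log2 (n%:R / ln n%:R : R)].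
  by near: n; exact: near_scales.
have n0 : (0 < n)%N := ln_ge1_nat_gt0 ln1.
have nR : 0 < n%:R :> R by rewrite ltr0n.
have lnn0 : 0 < ln (n%:R : R) by lra.
have log0 : 0 <= log2 (n%:R : R) by rewrite divr_ge0 ?(ltW l2) ?(ltW lnn0).
apply: ge_ereal_sup => _ [theta thetaM <-].
pose y : R := n%:R / ln n%:R.
have y0 : 0 < y by rewrite divr_gt0.
have y1 : 1 <= y by rewrite ler_pdivlMr// mul1r ltW// ln_sublinear.
have yn : y <= n%:R by rewrite ler_pdivrMr// ler_peMr// ltW.
have rhoE a : (ln n%:R / n%:R) `^ a = y `^ (- a).
  by rewrite powRN -(powR_inv1 (powR_ge0 _ _)) powRAC powR_inv1 ?(ltW y0)// invf_div.
have n_le_y a : 0 <= a -> n%:R `^ (- a) <= y `^ (- a).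
  move=> a0; rewrite !powRN lef_pV2 ?posrE ?powR_gt0//.
  by rewrite ge0_ler_powR ?nnegrE ?(ltW y0) ?(ltW nR).
pose x : R := r / D * log2 y.
have powRx a : 2 `^ (a * x) = y `^ (a * (r / D)).
  by rewrite -(powR_log2 _ y0) -mulrA.
have xw : x <= r / G * log2 n%:R.
  apply: (@le_trans _ _ (r / D * log2 n%:R)).
    by rewrite ler_pM2l ?divr_gt0// ler_pM2r ?invr_gt0// ler_ln ?posrE.
  by rewrite ler_wpM2r// ler_pM2l// lef_pV2 ?posrE// DG lerDr ltW// mulr_gt0.
pose F := K * y `^ (- (r * h)).
have F0 : 0 < F by rewrite mulr_gt0// powR_gt0.
(* The logarithm of the rate enters through [L ^ d <= r ln n]; then [ln n <= (ln n) ^ r], as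
   [r >= 1] and [ln n >= 1], gives the power of [y = n / ln n]. *)
have threshold_le j :
    block_threshold (d := d) r delta lambda n j <= lambda * r * y `^ (- r) * 2 `^ (delta * j%:R).
  rewrite /block_threshold mulrAC ler_wpM2r ?powR_ge0// -!mulrA ler_pM2l//.
  apply: (@le_trans _ _ (n%:R `^ (- r) * (r * ln n%:R))).
    by rewrite ler_wpM2l ?powR_ge0// blen_exp_le.
  rewrite mulrCA ler_pM2l// -rhoE powRM ?(ltW lnn0) ?invr_ge0 ?(ltW nR)//.
  rewrite mulrC -(powR_inv1 (ltW nR)) -powRrM mulN1r ler_wpM2r ?powR_ge0//.
  exact: le1r_powR.
(* Up to [jhigh] the interpolated block bound applies, with decay [eta]. Beyond it the full energy
   is controlled by the l^2 embedding, with decay [2 e]. *)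
have bias j : x < j%:R -> \sum_l level_bias r delta lambda n theta (j := j) l <=
     F * 2 `^ (- (eta * j%:R)) +
     (if r / G * log2 n%:R < j%:R then F' * 2 `^ (- (2 * e * j%:R)) else 0).
  move=> _; have [jh|jh] := leqP j (jhigh mu ups delta r n).
    apply: ler_wpDr; first by case: ifP => // _; rewrite mulr_ge0 ?powR_ge0// ltW.
    apply: (@le_trans _ _ (\sum_l block_threshold (d := d) r delta lambda n j `^ h *
        2 `^ (- (p * e * j%:R)) * smooth_level s theta p%:E (j := j) l `^ p)).
      apply: ler_sum => l _; rewrite /level_bias jh.
      apply: level_block_lt2 => //; first exact: ltW.
      by apply: block_threshold_gt0 => //; exact: blen_gt0.
    rewrite -mulr_sumr; apply: (@le_trans _ _ (
      (lambda * r * y `^ (- r) * 2 `^ (delta * j%:R)) `^ h * 2 `^ (- (p * e * j%:R))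
        * (cs * M `^ p))).
      apply: ler_pM; rewrite ?mulr_ge0 ?powR_ge0//.
      - by apply: sumr_ge0 => l _; exact: powR_ge0.
      - rewrite ler_wpM2r ?powR_ge0// ge0_ler_powR ?nnegrE//.
        + by apply/ltW; apply: block_threshold_gt0 => //; exact: blen_gt0.
        + by rewrite !mulr_ge0 ?powR_ge0// ltW.
      - exact: (smooth_level_sum _ cs1 q0).
    rewrite powRM ?mulr_ge0 ?powR_ge0 ?(ltW lambda0) ?(ltW r0)//.
    rewrite powRM ?mulr_ge0 ?powR_ge0 ?(ltW lambda0) ?(ltW r0)//.
    rewrite -!powRrM /F /K (_ : - (eta * j%:R) =
      delta * j%:R * h + - (p * e * j%:R)); last by rewrite /eta; ring.
    by rewrite [2 `^ (_ - _)]gt0_powRD// mulNr le_eqVlt; apply/orP; left; apply/eqP; ring.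
  have w0 : 0 <= r / G * log2 n%:R by exact: mulr_ge0 (divr_ge0 (ltW r0) (ltW G0)) log0.
  have wj : r / G * log2 n%:R < j%:R by rewrite -truncn_lt_nat.
  rewrite wj; apply: ler_wpDl; first by rewrite mulr_ge0 ?powR_ge0 ?(ltW F0).
  apply: (@le_trans _ _ (\sum_l 2 `^ (- (2 * e * j%:R))
      * smooth_level s theta p%:E (j := j) l `^ 2)).
    apply: ler_sum => l _; apply: le_trans (level_sqr_lt2 _ _ _ p0 (ltW p2)).
    exact: level_bias_le_sqr.
  rewrite -mulr_sumr mulrC ler_wpM2r ?powR_ge0//.
  exact: (smooth_level_sum _ cs1 q0).
apply: (le_trans (risk_le n0 lambda0 cs1 (blen_gt0 r1 ln1) G0 Q10 A1n A2n jJ jx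
  xw eta0 e20 (ltW F0) (ltW F'0) bias)).
rewrite -/C1 -/C2 -/C3 lee_fin rhoE.
rewrite [leRHS]mulrDl [X in _ <= X + _]mulrDl [X in _ <= X + _ + _]mulrDl.
have rate_exp_le : 2 * s * r / D <= r.
  by rewrite ler_pdivrMr// mulrC ler_pM2l// DG lerDl ltW.
apply: lerD; first apply: lerD; first apply: lerD.
- rewrite ler_pM2l// -/G powRx.
  apply: (@le_trans _ _ (y `^ (- r) * y `^ (G * (r / D)))).
    by rewrite ler_wpM2r ?powR_ge0// n_le_y// ltW.
  by rewrite -gt0_powRD// variance_exponent.
- rewrite -[leRHS]mulrA ler_pM2l// -[leLHS]mulrA ler_pM2l//.
  rewrite -[- (eta * x)]mulNr powRx.
  rewrite -gt0_powRD// ler_powR// mulNr -opprD lerN2.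
  (* With [p = 2 - 2 h], one finds [h D + eta = 2 s + ups h], which is at least [2 s]. *)
  rewrite (_ : r * h + _ = (2 * s + ups * h) * r / D).
      by rewrite ler_pM2r ?invr_gt0// ler_pM2r// lerDl mulr_ge0.
  rewrite /eta pe /h (_ : ups = D - 2 * s - delta - dstar mu).
    by field; rewrite gt_eqF.
  by rewrite /D; ring.
- rewrite -[leRHS]mulrA ler_pM2l// ler_pM2l// -/G.
  rewrite (_ : - _ = - (2 * e * (r / G)) * log2 n%:R); last by ring.
  rewrite powR_log2//.
  apply: (@le_trans _ _ (y `^ (- (2 * e * (r / G))))).
    by apply: n_le_y; rewrite mulr_ge0 ?divr_ge0 ?ltW.
  rewrite ler_powR// lerN2 -!mulrA ler_pM2l//.
  rewrite !mulrA ler_pdivrMr// mulrAC ler_pdivlMr// -mulrA -[leRHS]mulrA.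
  rewrite [r * G]mulrC [r * D]mulrC !mulrA ler_pM2r// DG.
  (* The discarded scales cost [n ^ (- 2 e r / G)], so the required inequality is [s G <= e D]. The
     expression in [key] equals [e D - s G]; its first term is nonnegative by [s p > d_*], its
     second by [s p > (1 - p / 2) * G]. *)
  have key : 0 <= 2 * s * (s - dstar mu / p) + dstar mu * (s - (p^-1 - 1 / 2) * G).
    apply: addr_ge0.
      by rewrite mulr_ge0 ?mulr_ge0 ?(ltW s0)// subr_ge0 ler_pdivrMr// ltW.
    rewrite mulr_ge0 ?(ltW dst0)// subr_ge0 -(ler_pM2r p0).
    apply: le_trans (ltW spG'); rewrite /h le_eqVlt; apply/orP; left; apply/eqP.
    by field; rewrite gt_eqF.
  rewrite -subr_ge0 (le_trans key)// le_eqVlt; apply/orP; left; apply/eqP.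
  by rewrite /e; field; rewrite gt_eqF.
- rewrite ler_pM2l ?mulr_gt0//; apply: (le_trans (n_le_y _ (ltW r0))).
  by rewrite ler_powR// lerN2.
Unshelve. all: by end_near. Qed.

End rates.

(** * The four cases of the theorem *)

Theorem theorem3p1 (R : realType) (d : nat) (r cs ups : R) (mu : 'I_d -> R)
  (hd : (0 < d)%N) (hr : 1 <= r <= d%:R) (hcs : 1 <= cs)
  (hups : 0 <= ups <= 1) (hmu : forall i, 0 < mu i)
  (dT : nat -> measure_display) (T : forall n, measurableType (dT n))
  (P : forall n, probability (T n) R)
  (z : forall n, noise_array (P n) cs ups mu)
  (delta lambda Q1 Q2 : R)
  (hdelta : 0 <= delta) (hlambda : 0 < lambda) (hQ1 : 0 < Q1) (hQ2 : 0 < Q2)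
  (hA1 : \forall n \near \oo, assumption_A1 r delta Q1 n (z n))
  (hA2 : \forall n \near \oo, assumption_A2 r delta lambda Q2 n (z n))
  (s : R) (p q : \bar R) (M : R)
  (hs : 0 < s) (hp : (0 < p)%E) (hq : (0 < q)%E) (hM : 0 < M) :
  let u := fun n => max_risk r delta lambda s p q M n (z n) in
  [/\
      ((q <= 2%:E)%E -> (2%:E <= p)%E ->
        bounded_by_rate u (fun n =>
          n%:R `^ (- (2 * s * r / (2 * s + delta + dstar mu + ups))))),
      ((q <= p)%E -> (p < 2%:E)%E ->
        s * fine p > Num.max (dstar mu)
                       ((1 - fine p / 2) * (delta + dstar mu + ups)) ->
        bounded_by_rate u (fun n =>
          (ln n%:R / n%:R) `^ (2 * s * r / (2 * s + delta + dstar mu + ups)))) &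

      (ups = 0 ->
        ((2%:E <= p)%E ->
          bounded_by_rate u (fun n =>
            n%:R `^ (- (2 * s * r / (2 * s + delta + dstar mu))))) /\
        ((p < 2%:E)%E ->
          s * fine p > Num.max (dstar mu)
                         ((1 - fine p / 2) * (delta + dstar mu)) ->
          bounded_by_rate u (fun n =>
            (ln n%:R / n%:R) `^ (2 * s * r / (2 * s + delta + dstar mu)))))].
Proof.
move=> u; case/andP: hr => r1 _; case/andP: hups => ups0 _.
have lt2 : (p < 2%:E)%E -> exists2 p', p = p'%:E & 0 < p' < 2.
  move: hp; rewrite /u; case: (p) => [p'| |] //; rewrite !lte_fin => p0 p2.
  by exists p' => //; rewrite p0.
split.
- move=> q2 p2; apply: (rate_ge2 (Q1 := Q1) (Q2 := Q2)) => //; by right.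
- move=> qp /lt2[p' pE /andP[p0 p2]]; rewrite /u pE /= => sp.
  by apply: (rate_lt2 (Q1 := Q1) (Q2 := Q2)) => //; right; rewrite -pE.
- move=> upsE; have ups_cancel a : a = a + ups by rewrite upsE addr0.
  split=> [p2|/lt2[p' pE /andP[p0 p2]]].
    rewrite (ups_cancel (2 * s + delta + dstar mu)).
    by apply: (rate_ge2 (Q1 := Q1) (Q2 := Q2)) => //; left.
  rewrite /u pE /= (ups_cancel (2 * s + delta + dstar mu)).
  rewrite (ups_cancel (delta + dstar mu)) => sp.
  by apply: (rate_lt2 (Q1 := Q1) (Q2 := Q2)) => //; left.
Qed.
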